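(* Let $m\ge1$ and $n\le2$. Let $u=(u_i)_{i=1}^m$ be a bounded solution of $L_i(u_i)=H_i(u)$ in $\mathbb R^n$, $1\le i\le m$, where the jump kernel $J=(J_i)_{i=1}^m$ satisfies either the finite range condition (F), or the decay condition (D) with $h_i(r)<Cr^{-\theta_i}$ for some $\theta_i>3$, $1\le i\le m$ (conditions (F) and (D) are stated in the context). If $H_i(u)\ge0$ in $\mathbb R^n$ for an index $1\le i\le m$, then $u_i$ is constant. In addition, if $\sum_{i=1}^m u_iH_i(u)\le0$ in $\mathbb R^n$, then all $u_i$ are constant.
   Context: Setting: a solution is $u=(u_i)_{i=1}^m$ with $u_i\in C^1(\mathbb R^n)$ and $|\nabla u_i|\in L^\infty(\mathbb R^n)$; $H=(H_i)_{i=1}^m$ is a sequence of locally Lipschitz functions $H_i:\mathbb R^m\to\mathbb R$. The nonlocal operator is $$L_i(f(x))=\lim_{\epsilon\to0}\int_{\mathbb R^n\setminus B_\epsilon(x)}[f(x)-f(z)]\,J_i(z-x)\,dz,$$ where each $J_i$ is a nonnegative, measurable, even jump kernel. Kernel conditions: for $1\le i\le m$, let $0<\alpha_i<2$, $0<\delta_i\le\kappa_i$, and let $c_i$ be a measurable even function with $\lambda_i\le c_i\le\Lambda_i$ for constants $0<\lambda_i\le\Lambda_i$. (F) (finite range) For all $i$, $\frac{c_i(x-z)}{|x-z|^{n+\alpha_i}}\mathbf 1_{\{|x-z|\le\delta_i\}}\le J_i(x-z)\le\frac{c_i(x-z)}{|x-z|^{n+\alpha_i}}\mathbf 1_{\{|x-z|\le\kappa_i\}}$.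 (D) (decay) For all $i$, $J_i(x-z)=\frac{c_i(x-z)}{|x-z|^{n+\alpha_i}}$ when $|x-z|\le\kappa_i$, and $\int_{r<|x-z|<2r}|J_i(x-z)|\,dz\le C\,h_i(r)$ when $r>\kappa_i$, where $C>0$ is a constant and $0\le h_i\in C(\mathbb R^+)$ with $\lim_{r\to\infty}h_i(r)=0$. *)

(* Defs.v *)
From HB Require Import structures.
From mathcomp Require Import all_boot all_order all_algebra.
From mathcomp Require Import all_classical all_reals all_analysis.
From mathcomp Require Import measurable_realfun.

Set Implicit Arguments.
Unset Strict Implicit.
Unset Printing Implicit Defensive.

Import Order.TTheory GRing.Theory Num.Theory.
Import numFieldNormedType.Exports.

Local Open Scope classical_set_scope.
Local Open Scope ring_scope.

(* R^n is 'rV[R]_n. The library makes it a normed space (for the sup norm) but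
   provides no sigma-algebra and no Lebesgue measure on it: the product (= Borel)
   sigma-algebra and the n-fold product of the one-dimensional Lebesgue measure
   are built here. *)
Section measurable_rV.
Context {R : realType}.
Variable n : nat.

Let coors : 'I_n -> 'rV[R]_n -> measurableTypeR R := fun j x => x ord0 j.

Let rV_set0 : g_sigma_preimage coors set0.
Proof. exact: sigma_algebra0. Qed.

Let rV_setC A : g_sigma_preimage coors A -> g_sigma_preimage coors (~` A).
Proof. exact: sigma_algebraC. Qed.

Let rV_bigcup (F : _^nat) : (forall i, g_sigma_preimage coors (F i)) ->
  g_sigma_preimage coors (\bigcup_i (F i)).
Proof. exact: sigma_algebra_bigcup. Qed.

HB.instance Definition _ := @isMeasurable.Build default_measure_display
  'rV[R]_n (g_sigma_preimage coors) rV_set0 rV_setC rV_bigcup.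

Lemma measurable_coord (j : 'I_n) :
  measurable_fun [set: 'rV[R]_n]
    (fun x : 'rV[R]_n => x ord0 j : measurableTypeR R).
Proof.
move=> _ Y mY; rewrite setTI; apply: sub_sigma_algebra => /=.
rewrite -bigcup_seq/=; exists j => /=; first by rewrite mem_index_enum.
by exists Y => //; rewrite setTI.
Qed.

Lemma measurable_fun_coordP d (T : measurableType d) (f : T -> 'rV[R]_n) :
  (forall j, measurable_fun [set: T]
     (fun x => f x ord0 j : measurableTypeR R)) ->
  measurable_fun [set: T] f.
Proof.
move=> mf _ A mA; rewrite setTI.
have: g_sigma_preimage coors `<=` [set A | measurable (f @^-1` A)].
  apply: smallest_sub.
    split => /=; first by rewrite preimage_set0.
      by move=> B mB; rewrite setTD -preimage_setC; exact: measurableC.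
    by move=> F mF; rewrite preimage_bigcup; exact: bigcup_measurable.
  rewrite -bigcup_seq => B [j _ [C mC <-]] /=.
  by have := mf j measurableT C mC; rewrite !setTI.
exact.
Qed.

End measurable_rV.

Section lebesgue_rV_step.
Context {R : realType}.
Variables (n : nat) (mu : {sigma_finite_measure set 'rV[R]_n -> \bar R}).

Definition rV_cons (p : measurableTypeR R * 'rV[R]_n) : 'rV[R]_n.+1 :=
  \row_j oapp (fun k => p.2 ord0 k) p.1 (unlift ord0 j).

Definition rV_uncons (x : 'rV[R]_n.+1) : measurableTypeR R * 'rV[R]_n :=
  (x ord0 ord0, \row_k x ord0 (lift ord0 k)).

Lemma rV_consK : cancel rV_cons rV_uncons.
Proof.
move=> [a x]; congr pair => /=; first by rewrite mxE unlift_none.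
by apply/rowP => k; rewrite !mxE liftK.
Qed.

Lemma measurable_rV_cons : measurable_fun setT rV_cons.
Proof.
apply: measurable_fun_coordP => j.
case: (unliftP ord0 j) => [k ->|->].
  apply: (eq_measurable_fun
      ((fun x : 'rV[R]_n => x ord0 k : measurableTypeR R) \o snd)).
    by move=> p _; rewrite /= mxE liftK.
  exact: (measurableT_comp (measurable_coord k) measurable_snd).
apply: (eq_measurable_fun fst); last exact: measurable_fst.
by move=> p _; rewrite mxE unlift_none.
Qed.

Lemma measurable_rV_uncons : measurable_fun setT rV_uncons.
Proof.
apply: measurable_fun_pair => /=; first exact: measurable_coord.
apply: measurable_fun_coordP => k.
apply: (eq_measurable_fun
  (fun x : 'rV[R]_n.+1 => x ord0 (lift ord0 k) : measurableTypeR R)).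
  by move=> x _; rewrite mxE.
exact: measurable_coord.
Qed.

Definition lebesgue_rV_step : set 'rV[R]_n.+1 -> \bar R :=
  pushforward (@product_measure1 _ _ (measurableTypeR R) 'rV[R]_n R
    lebesgue_measure mu) rV_cons.

Let lebesgue_rV_step0 : lebesgue_rV_step set0 = 0%E.
Proof. by rewrite /lebesgue_rV_step /pushforward preimage_set0 measure0. Qed.

Let lebesgue_rV_step_ge0 A : (0 <= lebesgue_rV_step A)%E.
Proof. by rewrite /lebesgue_rV_step /pushforward; exact: measure_ge0. Qed.

Let lebesgue_rV_step_sigma_additive : semi_sigma_additive lebesgue_rV_step.
Proof.
have mcons B : measurable B -> measurable (rV_cons @^-1` B).
  by move=> mB; rewrite -[X in measurable X]setTI; exact: measurable_rV_cons.
move=> F mF tF mUF; rewrite /lebesgue_rV_step /pushforward preimage_bigcup.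
apply: measure_semi_sigma_additive.
- by move=> k; exact: mcons.
- apply/trivIsetP => /= i j _ _ ij; rewrite -preimage_setI.
  by move/trivIsetP : tF => /(_ _ _ _ _ ij) ->//; rewrite preimage_set0.
- by rewrite -preimage_bigcup; exact: mcons.
Qed.

HB.instance Definition _ := isMeasure.Build _ _ _ lebesgue_rV_step
  lebesgue_rV_step0 lebesgue_rV_step_ge0 lebesgue_rV_step_sigma_additive.

Let lebesgue_rV_step_sigma_finite : sigma_finite setT lebesgue_rV_step.
Proof.
have /sigma_finiteP[F [TF ndF Foo]] := sigma_finiteT (@lebesgue_measure R).
have /sigma_finiteP[G [TG ndG Goo]] := sigma_finiteT mu.
exists (fun k => rV_uncons @^-1` (F k `*` G k)).
  rewrite -preimage_bigcup -[LHS](preimage_setT rV_uncons); congr (_ @^-1` _).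
  rewrite -setXTT TF TG predeqE => -[x y]; split.
    move=> [/= [a _ Fax] [b _ Gby]]; exists (maxn a b) => //; split.
    - by move: x Fax; exact/subsetPset/ndF/leq_maxl.
    - by move: y Gby; exact/subsetPset/ndG/leq_maxr.
  by move=> [a _ []/= ? ?]; split; exists a.
move=> k; have [mFk Fk] := Foo k; have [mGk Gk] := Goo k; split.
  rewrite -[X in measurable X]setTI.
  by apply: measurable_rV_uncons => //; exact: measurableX.
rewrite /lebesgue_rV_step /pushforward -comp_preimage.
rewrite (_ : rV_uncons \o rV_cons = id); last first.
  by apply/funext => p; exact: rV_consK.
by rewrite preimage_id product_measure1E// lte_mul_pinfty// ge0_fin_numE.
Qed.

HB.instance Definition _ := Measure_isSigmaFinite.Build _ _ _
  lebesgue_rV_step lebesgue_rV_step_sigma_finite.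

End lebesgue_rV_step.

Fixpoint lebesgue_rV (R : realType) (n : nat) :
    {sigma_finite_measure set 'rV[R]_n -> \bar R} :=
  if n is k.+1 then lebesgue_rV_step (lebesgue_rV R k) else \d_(0 : 'rV[R]_0).

Section euclidean.
Context {R : realType} {n : nat}.
Implicit Types (f : 'rV[R]_n -> R) (x : 'rV[R]_n).

(* The norm `|x| of the library on 'rV[R]_n is the sup norm. *)
Definition enorm x : R := Num.sqrt (\sum_(j < n) x ord0 j ^+ 2).

Definition eball x (r : R) : set 'rV[R]_n := [set z | enorm (z - x) < r].

Definition gradient f x : 'rV[R]_n := \row_j 'D_(delta_mx ord0 j) f x.

Definition C1 f : Prop :=
  (forall x, differentiable f x) /\ continuous (gradient f).

Definition gradient_Linfty f : Prop :=
  (Lnorm (lebesgue_rV R n) +oo (fun x => (enorm (gradient f x))%:E) < +oo)%E.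

(* Measurability with respect to the completion of the Borel sigma-algebra.
   Library integrals of such functions are the usual ones, the integral of a
   nonnegative function being a supremum over Borel simple functions below it. *)
Definition lebesgue_measurable f : Prop :=
  forall B : set R, measurable B ->
    completed_algebra_gen (lebesgue_rV R n) (f @^-1` B).

Definition even_fun f : Prop := forall x, f (- x) = f x.

Definition jump_kernel (K : 'rV[R]_n -> R) : Prop :=
  [/\ forall x, 0 <= K x, lebesgue_measurable K & even_fun K].

Definition truncated_operator (K : 'rV[R]_n -> R) f x (eps : R) : \bar R :=
  (\int[lebesgue_rV R n]_(z in ~` eball x eps)
     ((f x - f z) * K (z - x))%:E)%E.

(* The principal value defining L(f(x)) exists and equals l. *)
Definition nonlocal_operator_at (K : 'rV[R]_n -> R) f x (l : R) : Prop :=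
  truncated_operator K f x eps @[eps --> 0^'+] --> l%:E.

End euclidean.

Definition locally_lipschitz (R : realType) (m : nat) (G : 'rV[R]_m -> R) :
    Prop :=
  forall y : 'rV[R]_m, exists2 U, nbhs y U & [lipschitz G x | x in U].

Section system.
Context {R : realType} {m n : nat}.
Implicit Types (J c : 'I_m -> 'rV[R]_n -> R) (alpha : 'I_m -> R).

Definition state (u : 'I_m -> 'rV[R]_n -> R) (x : 'rV[R]_n) : 'rV[R]_m :=
  \row_i u i x.

Definition solution J (H : 'I_m -> 'rV[R]_m -> R) (u : 'I_m -> 'rV[R]_n -> R) :
    Prop :=
  [/\ forall i, C1 (u i),
      forall i, gradient_Linfty (u i) &
      forall i x, nonlocal_operator_at (J i) (u i) x (H i (state u x))].

Definition model_kernel c alpha (i : 'I_m) (w : 'rV[R]_n) : R :=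
  c i w / enorm w `^ (n%:R + alpha i).

(* The model kernel is singular at the origin, where its value in Rocq is the
   junk value 0; the pointwise conditions are imposed off the diagonal. *)
Definition finite_range J c alpha (delta kappa : 'I_m -> R) : Prop :=
  forall i x z, x != z ->
    model_kernel c alpha i (x - z) *
        \1_[set w | enorm w <= delta i] (x - z) <= J i (x - z) /\
    J i (x - z) <=
      model_kernel c alpha i (x - z) *
        \1_[set w | enorm w <= kappa i] (x - z).

Definition decay J c alpha (kappa : 'I_m -> R) (C : R) (h : 'I_m -> R -> R) :
    Prop :=
  forall i,
  [/\ forall x z, x != z -> enorm (x - z) <= kappa i ->
        J i (x - z) = model_kernel c alpha i (x - z),
      forall x r, kappa i < r ->
        (\int[lebesgue_rV R n]_(z in [set z | (r < enorm (x - z) < 2 * r)%R])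
           `|J i (x - z)|%:E <= (C * h i r)%:E)%E,
      forall r, 0 < r -> 0 <= h i r,
      {within `]0, +oo[, continuous (h i)} &
      h i r @[r --> +oo] --> 0].

End system.

(* Main.v *)
(* Let L be the operator of a kernel J with finite second moment and let L u = f
   pointwise, in the principal value sense, with u Lipschitz.

   Weak form.  The principal values may converge badly, so they cannot simply be
   integrated.  Instead u is replaced by its inf-convolution v, which is
   semiconcave and satisfies L v(x) >= L u(y) at a point y near x for every
   truncation of the operator.  Testing against g >= 0 and letting v tend to u
   gives 2 int g f <= int int (u(x + w) - u(x)) (g(x + w) - g(x)) J(w) dx dw;
   applied also to - u, this is an equality.

   Liouville property.  Testing with g = eta^2 u and summing over the system, the
   sign condition sum_i u_i f_i <= 0 bounds the energies weighted by eta^2 by the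
   Dirichlet energy of eta.  Since n <= 2, an average of eta over dyadic scales
   makes the latter arbitrarily small, so the energies vanish and each u_i is
   constant, the kernel being positive near 0.

   If only H_i(u) >= 0 is known, then (u_i - M) H_i(u) <= 0 for M >= sup u_i, and
   the same argument applies to the single function u_i - M. *)
From HB Require Import structures.
Require Import Defs.
From mathcomp Require Import all_boot all_order all_algebra.
From mathcomp Require Import all_classical all_reals all_analysis.
From mathcomp Require Import measurable_realfun ring lra.
Import Order.TTheory GRing.Theory Num.Theory.
Import numFieldNormedType.Exports.
Set Implicit Arguments.
Unset Strict Implicit.
Unset Printing Implicit Defensive.
Local Open Scope classical_set_scope.
Local Open Scope ring_scope.

(** * Lebesgue measure on row vectors *)

Section rV_measure.
Context {R : realType}.

(** The weak form holds a priori only for nonnegative Lipschitz test functions of bounded support,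
    since it rests on Tonelli for a nonnegative integrand. So [eta^2 u] is split as
    [eta^2 (u + M) - M eta^2] with [M >= |u|]: the first piece is tested in the equation of [- u],
    the second in that of [u], and the two inequalities add up. The limit in the inf-convolutions is
    dominated because these keep the Lipschitz constant of [u]: the energy at increment [w] is at
    most a constant times [|w|^2]. This is integrable against the kernel, near the origin because
    [alpha_i < 2], at infinity because [r^2] times the mass of the annulus at radius [r] is summable
    over geometric radii. The cutoff descends through the [N] dyadic scales from [2^N] to [2^(2N)];
    for [n <= 2] a single scale has bounded Dirichlet energy, and averaging leaves [O(1 / N)].
    Kernels are measurable only for the completed sigma-algebra, whereas Fubini and changes of
    variables are used for Borel functions; each kernel is therefore replaced by a Borel one, equal
    to it off a null set. *)

Lemma le_coord_norm n (x : 'rV[R]_n) i : `|x ord0 i| <= `|x|.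
Proof.
by rewrite [leRHS]/Num.norm /= mx_normrE; apply/bigmax_geP; right => /=; exists (ord0, i).
Qed.

Lemma norm_le_coord n (x : 'rV[R]_n) (r : R) : 0 <= r ->
  (forall i, `|x ord0 i| <= r) -> `|x| <= r.
Proof.
move=> r0 h; rewrite [leLHS]/Num.norm /= mx_normrE; apply/bigmax_leP; split => //.
by case=> i j _ /=; rewrite ord1.
Qed.

(** The sigma-algebra is generated by the coordinates, so [U] is exhausted by the countably many
    cubes with rational centre and half side [1 / k.+1] that it contains. *)
Lemma open_measurable_rV n (U : set 'rV[R]_n) : open U -> measurable U.
Proof.
move=> oU.
pose B (p : 'rV[rat]_n * nat) : set 'rV[R]_n :=
  [set y | forall j, y ord0 j \in `]ratr (p.1 ord0 j) - p.2.+1%:R^-1, ratr (p.1 ord0 j) +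
    p.2.+1%:R^-1[].
pose F p := if pselect (B p `<=` U) then B p else set0.
have -> : U = \bigcup_p F p.
  apply/seteqP; split; last first.
    by move=> x [p _]; rewrite /F; case: pselect => // h /h.
  move=> x Ux.
  have := open_nbhs_nbhs (conj oU Ux) => /nbhs_ballP[e /= e0 eU].
  (* Two points of such a cube are at sup distance at most [2 / k.+1], so a cube containing [x] lies
     in the ball of radius [e]. *)
  have [k ke] : exists k, k.+1%:R^-1 < e / 2 :> R.
    have := near_infty_natSinv_lt (PosNum (divr_gt0 e0 (ltr0n _ 2))).
    by move=> [k _ hk]; exists k; exact: (hk k (leqnn k)).
  have hq j : {q : rat | ratr q \in `]x ord0 j - k.+1%:R^-1, x ord0 j + k.+1%:R^-1[}.
    apply: cid; apply: rat_in_itvoo.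
    by rewrite -subr_gt0 opprB addrC addrA subrK -mulr2n pmulrn_lgt0// invr_gt0.
  exists (\row_j sval (hq j), k) => //.
  have Bx : B (\row_j sval (hq j), k) x.
    move=> j /=; rewrite mxE; case: (hq j) => q /= /[!in_itv]/= /andP[h1 h2].
    by rewrite ltrBlDr h2 /=; rewrite -ltrBlDr.
  rewrite /F; case: pselect => // -[] y By; apply: eU.
  rewrite -ball_normE /=; apply: (@le_lt_trans _ _ (2 * k.+1%:R^-1));
    last by rewrite mulrC -ltr_pdivlMr.
  apply: norm_le_coord => [|j]; first by rewrite mulr_ge0// invr_ge0.
  move: (Bx j) (By j) => /=; rewrite !mxE !in_itv/=.
  move: (sval (hq j)) => q; move: (ratr q) (k.+1%:R^-1) => c d.
  move=> /andP[? ?] /andP[? ?].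
  by rewrite ler_norml; apply/andP; split; lra.
apply: countable_bigcupT_measurable => // -[q k]; rewrite /F.
case: pselect => subU /=; last exact: measurable0.
have -> : B (q, k) = \bigcap_(j in [set: 'I_n])
   ((fun y : 'rV[R]_n => y ord0 j : measurableTypeR R) @^-1`
     `]ratr (q ord0 j) - k.+1%:R^-1, ratr (q ord0 j) + k.+1%:R^-1[).
  by apply/seteqP; split => [y By j _|y By j]; exact: By.
apply: fin_bigcap_measurable => [|j _]; first exact: finite_finset.
by rewrite -[X in measurable X]setTI; exact: (measurable_coord j).
Qed.

Lemma continuous_measurable_rV n (f : 'rV[R]_n -> R) :
  continuous f -> measurable_fun setT f.
Proof.
move=> cf; apply: (measurability _ (RGenOInfty.measurableE R)) => _ [_ [a ->] <-].
rewrite setTI; apply: open_measurable_rV.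
by move/continuousP : cf; apply; exact: interval_open.
Qed.

(** Translation invariance follows from uniqueness of the measure with given values on half-open
    intervals. Allowing both signs of [s] lets one statement cover translations and reflections. *)
Lemma lebesgue_measure_affine (s a : R) (A : set (measurableTypeR R)) :
  s = 1 \/ s = -1 -> measurable A ->
  lebesgue_measure ((fun t => s * t + a) @^-1` A) = lebesgue_measure A.
Proof.
have mshift (b : R) : measurable_fun setT
  (fun t : measurableTypeR R => t + b : measurableTypeR R).
  by apply: continuous_measurable_fun => t; apply: cvgD; [exact: cvg_id|exact: cvg_cst].
have shift (b : R) (B : set (measurableTypeR R)) : measurable B ->
    lebesgue_measure ((fun t => t + b) @^-1` B) = lebesgue_measure B.
  move=> mB.
  pose mfm := isMeasurableFun.Build _ _ _ _ _ (mshift b).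
  pose fm : {mfun measurableTypeR R >-> measurableTypeR R} :=
    HB.pack (fun t : measurableTypeR R => t + b : measurableTypeR R) mfm.
  apply/esym; apply: (@lebesgue_measure_unique _ (pushforward lebesgue_measure fm)) => //= _
    [[x y]] _ <-.
  rewrite /pushforward (_ : fm @^-1` `]x, y] = `]x - b, y - b])%classic; last first.
    by apply/seteqP; split => t /=; rewrite !in_itv/= /fm /= ltrBlDr lerBrDr.
  rewrite !lebesgue_measure_itv/= !lte_fin ltrD2r; case: ifP => // _.
  by rewrite -!EFinD; congr EFin; ring.
move=> [->|->] mA; first by under eq_fun do rewrite mul1r; exact: shift.
have mA' : measurable ((fun t : measurableTypeR R => t + a : measurableTypeR R) @^-1` A).
  by rewrite -[X in measurable X]setTI; exact: mshift.
rewrite -[RHS](shift a)// -[RHS]lebesgue_measureN// /pushforward.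
by congr (lebesgue_measure _); apply/seteqP; split => t /=; rewrite mulN1r.
Qed.

Lemma measurable_rV_affine n (s : R) (a : 'rV[R]_n) :
  measurable_fun setT (fun x : 'rV[R]_n => s *: x + a).
Proof.
apply: measurable_fun_coordP => j.
apply: (eq_measurable_fun (fun x : 'rV[R]_n => s * x ord0 j + a ord0 j : measurableTypeR R)).
  by move=> x _; rewrite !mxE.
by apply: measurable_funD => //; apply: measurable_funM => //; exact: measurable_coord.
Qed.

(** Induction on the dimension: the section at [t] of the preimage of [A] is an affine preimage of
    the section of [A] at [s * t + a0], so the one-dimensional invariance finishes the product
    integral. *)
Lemma lebesgue_rV_affine n (s : R) (a : 'rV[R]_n) (A : set 'rV[R]_n) :
  s = 1 \/ s = -1 -> measurable A ->
  lebesgue_rV R n ((fun x => s *: x + a) @^-1` A) = lebesgue_rV R n A.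
Proof.
move=> hs; elim: n a A => [|n IH] a A mA.
  rewrite /= !diracE; congr (_%:E); congr (_%:R); congr nat_of_bool.
  by apply/idP/idP => /set_mem h; apply/mem_set; move: h => /=; rewrite [_ + a]thinmx0.
have mcons (B : set 'rV[R]_n.+1) : measurable B -> measurable (@rV_cons R n @^-1` B).
  by move=> mB; rewrite -[X in measurable X]setTI; exact: measurable_rV_cons.
have maff (B : set 'rV[R]_n.+1) : measurable B -> measurable ((fun x => s *: x + a) @^-1` B).
  by move=> mB; rewrite -[X in measurable X]setTI; exact: measurable_rV_affine.
rewrite /= /lebesgue_rV_step /pushforward /=.
rewrite /product_measure1.
pose a0 := a ord0 ord0; pose a' : 'rV[R]_n := \row_k a ord0 (lift ord0 k).
pose F (t : measurableTypeR R) := lebesgue_rV R n (xsection (@rV_cons R n @^-1` A) t).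
have mF : measurable_fun setT F.
  by apply: measurable_fun_xsection; exact: mcons.
transitivity (\int[lebesgue_measure]_t F (s * t + a0)%R)%E.
  apply: eq_integral => t _; rewrite /= /F.
  rewrite -[RHS](IH a'); last by refine (measurable_xsection _ _); exact: mcons.
  have E y : s *: rV_cons (t, y) + a = rV_cons (s * t + a0, s *: y + a').
    apply/rowP => j; rewrite !mxE; case: (unliftP ord0 j) => [k ->|->].
      by rewrite /= !mxE.
    by [].
  by congr (lebesgue_rV R n _); apply/seteqP; split => y; rewrite /xsection /= !inE /= E.
have maffR : measurable_fun setT (fun t : measurableTypeR R => s * t + a0 : measurableTypeR R).
  by apply: measurable_funD => //; exact: measurable_funM.
rewrite -(@ge0_integral_pushforward _ _ _ _ _ _ maffR lebesgue_measure setT F)//=.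
apply: eq_measure_integral => //= B mB _.
exact: lebesgue_measure_affine.
Qed.

Lemma ge0_integral_rV_affine n (s : R) (a : 'rV[R]_n) (f : 'rV[R]_n -> \bar R) :
  s = 1 \/ s = -1 -> measurable_fun setT f -> (forall x, 0 <= f x)%E ->
  (\int[lebesgue_rV R n]_x f (s *: x + a)%R = \int[lebesgue_rV R n]_x f x)%E.
Proof.
move=> hs mf f0.
rewrite -(@ge0_integral_pushforward _ _ _ _ _ _ (measurable_rV_affine s a) (lebesgue_rV R n)
  setT f)//=.
apply: eq_measure_integral => //= [|_ B mB _]; first exact: measurable_rV_affine.
exact: lebesgue_rV_affine.
Qed.

Lemma integral_rV_affine n (s : R) (a : 'rV[R]_n) (f : 'rV[R]_n -> \bar R) :
  s = 1 \/ s = -1 -> measurable_fun setT f ->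
  (\int[lebesgue_rV R n]_x f (s *: x + a)%R = \int[lebesgue_rV R n]_x f x)%E.
Proof.
move=> hs mf; rewrite integralE [RHS]integralE; congr (_ - _)%E.
  apply: etrans; last apply: (@ge0_integral_rV_affine _ s a (f^\+)%E hs) => //;
    last exact: measurable_funepos.
  by apply: eq_integral => x _; rewrite !funeposE.
apply: etrans; last apply: (@ge0_integral_rV_affine _ s a (f^\-)%E hs) => //;
  last exact: measurable_funeneg.
by apply: eq_integral => x _; rewrite !funenegE.
Qed.

Definition box n (r : R) : set 'rV[R]_n := [set x | `|x| <= r].
Arguments box n r : clear implicits.

Lemma measurable_norm n : measurable_fun setT (fun x : 'rV[R]_n => `|x|).
Proof. by apply: continuous_measurable_rV; exact: norm_continuous. Qed.

Lemma measurable_box n r : measurable (box n r).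
Proof.
have := @measurable_norm n measurableT `]-oo, r]%classic (measurable_itv _).
by rewrite setTI; congr measurable; apply/seteqP; split => x; rewrite /= in_itv.
Qed.

Lemma lebesgue_rV_box n (r : R) : 0 <= r ->
  lebesgue_rV R n (box n r) = ((2 * r) ^+ n)%:E.
Proof.
move=> r0; elim: n => [|n IH].
  by rewrite /= diracE mem_set// /box /= normr0.
rewrite /= /lebesgue_rV_step /pushforward /=.
have -> : @rV_cons R n @^-1` box n.+1 r = `[- r, r]%classic `*` box n r.
  apply/seteqP; split => -[t y] /=; rewrite /box /= in_itv /= -ler_norml.
    move=> h; split.
      by have := le_trans (le_coord_norm _ ord0) h; rewrite mxE unlift_none.
    apply: norm_le_coord => // i.
    by have := le_trans (le_coord_norm _ (lift ord0 i)) h; rewrite mxE liftK.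
  move=> [h1 h2]; apply: norm_le_coord => // i; rewrite mxE.
  case: (unliftP ord0 i) => [k _|_] //=.
  exact: le_trans (le_coord_norm _ _) h2.
rewrite product_measure1E//; last exact: measurable_box.
rewrite IH exprS EFinM; congr (_ * _)%E.
rewrite /= lebesgue_measure_itv/= lte_fin; case: ltP => h.
  by rewrite -EFinD; congr EFin; ring.
by congr EFin; lra.
Qed.

End rV_measure.
Arguments box {R} n r.

(** * Borel versions of completion-measurable functions *)

Section null_modification.
Local Open Scope ereal_scope.
Context d (T : measurableType d) (R : realType) (mu : {measure set T -> \bar R}).
Import HBNNSimple.

(* No measurability is assumed of [f] and [g]: kernels measurable only for the
   completed sigma-algebra are compared with Borel ones through this lemma. *)
Lemma ge0_le_integral_off_null (D N : set T) (f g : T -> \bar R) :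
  measurable D -> measurable N -> mu N = 0 ->
  (forall x, 0 <= f x) -> (forall x, 0 <= g x) ->
  (forall x, D x -> ~ N x -> f x <= g x) ->
  \int[mu]_(x in D) f x <= \int[mu]_(x in D) g x.
Proof.
move=> mD mN N0 f0 g0 fg.
rewrite !ge0_integralE //; apply: ge_ereal_sup => _ [h /= hf <-].
apply: ereal_sup_ubound.
have mC : measurable (~` N) by exact: measurableC.
exists (proj_nnsfun h mC).
  move=> x; rewrite /= patchE; case: ifPn => xD; last first.
    have := hf x; rewrite patchE (negbTE xD) lee_fin => hx.
    by rewrite lee_fin mindicE; case: (_ \in _); rewrite ?mulr1 ?mulr0.
  rewrite mindicE; case: (boolP (x \in ~` N)) => xN; last by rewrite mulr0.
  rewrite mulr1; apply: le_trans (fg x _ _); [|exact: set_mem|exact: (set_mem xN)].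
  by have := hf x; rewrite patchE xD.
rewrite -!integralT_nnsfun; apply: ge0_ae_eq_integral => //.
- by apply/measurable_EFinP; exact: measurable_funP.
- by apply/measurable_EFinP; exact: measurable_funP.
- by move=> x _; rewrite lee_fin; exact: fun_ge0.
- by move=> x _; rewrite lee_fin; exact: fun_ge0.
exists N; split => // x /= hx; apply: contrapT => Nx; apply: hx => _.
by rewrite mindicE mem_set//= mulr1.
Qed.

Lemma eq_integral_off_null (D N : set T) (f g : T -> \bar R) :
  measurable D -> measurable N -> mu N = 0 ->
  (forall x, D x -> ~ N x -> f x = g x) ->
  \int[mu]_(x in D) f x = \int[mu]_(x in D) g x.
Proof.
move=> mD mN N0 fg; rewrite integralE [RHS]integralE; congr (_ - _).
  by apply/eqP; rewrite eq_le; apply/andP; split;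
    apply: (ge0_le_integral_off_null mD mN N0) => // x Dx Nx; rewrite !funeposE fg.
by apply/eqP; rewrite eq_le; apply/andP; split;
  apply: (ge0_le_integral_off_null mD mN N0) => // x Dx Nx; rewrite !funenegE fg.
Qed.

End null_modification.

Section borel_version.
Context {R : realType} {n : nat}.
Local Notation la := (lebesgue_rV R n).

(** Each superlevel set at a rational level is a Borel set up to part of a null set. With [Z] the
    union of these countably many null sets, [f > a] off [Z] is the union of the Borel sets of the
    rational levels above [a]. *)
Lemma negligible_fun_borel (f : 'rV[R]_n -> R) : lebesgue_measurable f ->
  exists Z, [/\ measurable Z, la Z = 0%E & measurable_fun (~` Z) f].
Proof.
move=> mf.
have H (q : rat) : exists AM : set 'rV[R]_n * set 'rV[R]_n,
  [/\ measurable AM.1, measurable AM.2, la AM.2 = 0%E &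
     AM.1 `<=` f @^-1` `]ratr q, +oo[ /\ f @^-1` `]ratr q, +oo[ `<=` AM.1 `|` AM.2].
  have [A mA [N [M [mM M0 NM]] AN]] := mf `]ratr q, +oo[%classic (measurable_itv _).
  exists (A, M); split => //=; rewrite -AN; split; first exact: subsetUl.
  exact: setUS.
pose AM q := sval (cid (H q)).
have AMP q : [/\ measurable (AM q).1, measurable (AM q).2, la (AM q).2 = 0%E &
     (AM q).1 `<=` f @^-1` `]ratr q, +oo[ /\ f @^-1` `]ratr q, +oo[ `<=` (AM q).1 `|` (AM q).2].
  exact: (svalP (cid (H q))).
have mZ : measurable (\bigcup_q (AM q).2).
  by apply: bigcupT_measurable_rat => q; case: (AMP q).
exists (\bigcup_q (AM q).2); split => //.
  apply: measure_negligible => //.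
  have -> : \bigcup_q (AM q).2 =
      \bigcup_k (if unpickle k is Some q then (AM q).2 else set0).
    apply/seteqP; split => x; first by move=> [q _ h]; exists (pickle q); rewrite ?pickleK.
    by move=> [k _]; case: unpickle => // q h; exists q.
  apply: negligible_bigcup => k; case: unpickle => [q|]; last exact: negligible_set0.
  by case: (AMP q) => _ h1 h2 _; apply/negligibleP.
apply: (measurability _ (RGenOInfty.measurableE R)) => _ [_ [a ->] <-].
rewrite (_ : _ `&` _ = ~` (\bigcup_q (AM q).2) `&`
   \bigcup_q (if (a < ratr q)%R then (AM q).1 else set0)); last first.
  apply/seteqP; split => x [Zx]; last first.
    move=> [q _]; case: ifPn => // aq Ax; split => //=.
    have [_ _ _ [h _]] := AMP q; have := h _ Ax.
    by rewrite /= !in_itv/= !andbT => /(lt_trans aq).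
  rewrite /= in_itv/= andbT => afx; split => //.
  have [q] := rat_in_itvoo afx; rewrite in_itv/= => /andP[aq qf].
  exists q => //; rewrite aq.
  have [_ _ _ [_ h]] := AMP q; have /h[//|Mx] : (f @^-1` `]ratr q, +oo[) x.
    by rewrite /= in_itv/= qf.
  by exfalso; apply: Zx; exists q.
apply: measurableI; first exact: measurableC.
by apply: bigcupT_measurable_rat => q; case: ifP => // _; case: (AMP q).
Qed.

(** The exceptional set is replaced by its union with its mirror image, so that putting the value
    [0] on it preserves evenness. *)
Lemma even_borel_version (f : 'rV[R]_n -> R) :
  lebesgue_measurable f -> even_fun f ->
  exists Z, [/\ measurable Z, la Z = 0%E, measurable_fun setT (f \* \1_(~` Z)) &
    even_fun (f \* \1_(~` Z))].
Proof.
move=> mf ef; have [Z [mZ Z0 mfZ]] := negligible_fun_borel mf.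
pose Zm := (fun x : 'rV[R]_n => -1 *: x + 0) @^-1` Z.
have mZm : measurable Zm.
  by rewrite -[X in measurable X]setTI; exact: measurable_rV_affine.
have Zm0 : la Zm = 0%E by rewrite /Zm lebesgue_rV_affine//; right.
have mU : measurable (Z `|` Zm) by exact: measurableU.
exists (Z `|` Zm); split => //.
- by rewrite null_set_setU.
- have -> : f \* \1_(~` (Z `|` Zm)) = f \_ (~` (Z `|` Zm)).
    by apply/funext => x; rewrite /= patchE indicE; case: ifP; rewrite ?mulr1 ?mulr0.
  apply/(measurable_restrict _ (measurableC mU) measurableT) => /=.
  rewrite setTI; apply: measurable_funS mfZ; first exact: measurableC.
  by apply: subsetC; exact: subsetUl.
- move=> x /=; rewrite ef; congr (_ * _); rewrite !indicE; congr (_%:R).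
  congr nat_of_bool; apply/idP/idP => /set_mem h; apply/mem_set; move: h => /=.
  all: by rewrite /Zm /= !scaleN1r !addr0 ?opprK; tauto.
Qed.

End borel_version.

(** * Euclidean norm and inf-convolution *)

Section sqnorm.
Context {R : realType} {n : nat}.
Implicit Types (x y z w : 'rV[R]_n).

Definition sqnorm x : R := \sum_(j < n) x ord0 j ^+ 2.

Lemma sqnorm_ge0 x : 0 <= sqnorm x.
Proof. by apply: sumr_ge0 => j _; exact: sqr_ge0. Qed.

Lemma sqnorm0 : sqnorm 0 = 0.
Proof. by rewrite /sqnorm big1// => j _; rewrite mxE expr0n. Qed.

Lemma sqnormN x : sqnorm (- x) = sqnorm x.
Proof. by apply: eq_bigr => j _; rewrite mxE sqrrN. Qed.

Lemma sqnorm_parallelogram x y :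
  sqnorm (x + y) + sqnorm (x - y) = 2 * sqnorm x + 2 * sqnorm y.
Proof.
rewrite /sqnorm -big_split /= !mulr_sumr -big_split; apply: eq_bigr => j _ /=.
by rewrite !mxE; ring.
Qed.

Lemma norm_le_sqnorm x : `|x| ^+ 2 <= sqnorm x.
Proof.
rewrite -[leRHS]sqr_sqrtr ?sqnorm_ge0// lerXn2r ?nnegrE ?sqrtr_ge0//.
apply: norm_le_coord => [|i]; first exact: sqrtr_ge0.
rewrite -sqrtr_sqr ler_wsqrtr// /sqnorm (bigD1 i)//= lerDl.
by apply: sumr_ge0 => j _; exact: sqr_ge0.
Qed.

Lemma sqnorm_le_norm x : sqnorm x <= n%:R * `|x| ^+ 2.
Proof.
rewrite mulr_natl -[X in _ *+ X]card_ord -sumr_const; apply: ler_sum => j _.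
by rewrite -[leLHS]real_normK ?num_real// lerXn2r ?nnegrE//; exact: le_coord_norm.
Qed.

Lemma enorm_ge0 x : 0 <= enorm x.
Proof. exact: sqrtr_ge0. Qed.

Lemma enorm_sq x : enorm x ^+ 2 = sqnorm x.
Proof. by rewrite sqr_sqrtr// sqnorm_ge0. Qed.

Lemma norm_le_enorm x : `|x| <= enorm x.
Proof.
by rewrite -(ler_pXn2r (ltn0Sn 1)) ?nnegrE// ?enorm_ge0// enorm_sq norm_le_sqnorm.
Qed.

Lemma enorm_le_norm x : enorm x <= n%:R * `|x|.
Proof.
rewrite -(ler_pXn2r (ltn0Sn 1)) ?nnegrE ?mulr_ge0 ?enorm_ge0//.
rewrite enorm_sq (le_trans (sqnorm_le_norm x))// exprMn ler_wpM2r ?sqr_ge0//.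
by rewrite -natrX ler_nat -mulnn; case: (n) => // k; rewrite leq_pmulr.
Qed.

Lemma continuous_of_lipschitz (f : 'rV[R]_n -> R) (L : R) :
  (forall x y, `|f x - f y| <= L * `|x - y|) -> continuous f.
Proof.
move=> fL x; apply/(@cvgrPdist_le _ _ _ _ (nbhs_filter x)) => e e0.
have L1 : 0 < `|L| + 1 by rewrite ltr_wpDl.
apply/nbhs_ballP; exists (e / (`|L| + 1)); first by rewrite /= divr_gt0.
move=> y; rewrite -ball_normE /= => /ltW; rewrite ler_pdivlMr// mulrC => h.
apply: (le_trans (fL _ _)); apply: le_trans h.
by rewrite ler_wpM2r// (le_trans (ler_norm _))// lerDl.
Qed.

Lemma continuous_coord (j : 'I_n) : continuous (fun x : 'rV[R]_n => x ord0 j).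
Proof.
apply: (@continuous_of_lipschitz _ 1) => x y; rewrite mul1r.
by have := le_coord_norm (x - y) j; rewrite !mxE.
Qed.

Lemma continuous_sqnorm : continuous sqnorm.
Proof.
rewrite /sqnorm; elim: (index_enum _) => [|j s IH].
  by under eq_fun do rewrite big_nil; exact: cst_continuous.
move=> x; under eq_fun do rewrite big_cons expr2.
apply: (@continuousD _ _ _ (fun x : 'rV[R]_n => x ord0 j * x ord0 j)
  (fun x => \sum_(j <- s) x ord0 j ^+ 2)); last exact: IH.
by apply: (@continuousM _ _ (fun x : 'rV[R]_n => x ord0 j) (fun x => x ord0 j));
  exact: continuous_coord.
Qed.

Lemma compact_ball x r : compact [set y | `|x - y| <= r].
Proof.
apply: bounded_closed_compact.
  exists (`|x| + r); split; first exact: num_real.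
  move=> M hM y /= h; rewrite -[y](subKr x) (le_trans (ler_normB _ _))//.
  by rewrite (le_trans _ (ltW hM))// lerD2l.
have -> : [set y | `|x - y| <= r] = (fun y => `|x - y|) @^-1` `]-oo, r]%classic.
  by apply/seteqP; split => y; rewrite /= in_itv.
apply: closed_comp => [y _|]; last exact: interval_closed.
apply: (@continuous_of_lipschitz _ 1) => {}y z; rewrite mul1r.
by rewrite (le_trans (ler_dist_dist _ _))// opprB addrC subrKA distrC.
Qed.

(* The infimum convolution of [u] with the parabola [sqnorm / (2 e)]: [v] is
   semiconcave, and at each [x] it lies above a translate of [u] at a nearby
   point [y], so truncated operators satisfy [L v x >= L u y]. *)
Lemma inf_convolution (u : 'rV[R]_n -> R) (L e : R) : 0 < e -> 0 <= L ->
  (forall x y, `|u x - u y| <= L * `|x - y|) ->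
  exists v, [/\ forall x y, `|v x - v y| <= L * `|x - y|,
    forall x, `|v x - u x| <= 2 * e * L ^+ 2,
    forall x z, v (x + z) + v (x - z) - 2 * v x <= sqnorm z / e &
    forall x, exists2 y, `|x - y| <= 2 * e * L &
      forall z, u y - u (y + z) <= v x - v (x + z)].
Proof.
move=> e0 L0 uL.
pose F x y := u y + sqnorm (x - y) / (2 * e).
have cu := continuous_of_lipschitz uL.
(* Beyond distance [2 * e * L] the parabola outweighs the gain [L * |x - z|] that [u] can offer, so
   [F x z >= F x x] there and the minimum over the compact ball is global. *)
have H x : exists y, `|x - y| <= 2 * e * L /\ forall z, F x y <= F x z.
  have rho0 : 0 <= 2 * e * L by rewrite !mulr_ge0// ltW.
  have xB : [set y | `|x - y| <= 2 * e * L] x by rewrite /= subrr normr0.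
  have [|y yB ymin] := @EVT_min_rV R n (F x) _ (ex_intro _ x xB) (@compact_ball x (2 * e * L)).
    apply: continuous_subspaceT => z.
    apply: (@continuousD _ _ _ u (fun y => sqnorm (x - y) / (2 * e))); first exact: cu.
    apply: (@continuousM _ _ (fun y => sqnorm (x - y)) (fun=> (2 * e)^-1));
      last exact: cst_continuous.
    apply: (@continuous_comp _ _ _ (fun y => x - y) sqnorm); last exact: continuous_sqnorm.
    by apply: (@continuousB _ _ _ (fun=> x) id) => //; exact: cst_continuous.
  exists y; split; first by move: yB; rewrite inE.
  move=> z; have [zB|zB] := leP `|x - z| (2 * e * L); first by apply: ymin; rewrite inE.
  apply: (@le_trans _ _ (F x x)); first by apply: ymin; rewrite inE.
  rewrite /F subrr sqnorm0 mul0r addr0 -lerBlDl.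
  apply: (le_trans (ler_norm _)); apply: (le_trans (uL _ _)).
  rewrite ler_pdivlMr ?mulr_gt0//; apply: le_trans (norm_le_sqnorm _).
  by rewrite expr2 (mulrC L) -mulrA ler_wpM2l//; lra.
pose y x := sval (cid (H x)).
have y1 x : `|x - y x| <= 2 * e * L by case: (svalP (cid (H x))).
have y2 x z : F x (y x) <= F x z by case: (svalP (cid (H x))) => _; exact.
pose v x := F x (y x).
(* Moving the minimiser [y x] along with [x] leaves the parabola term unchanged. The Lipschitz bound
   and the comparison with [u] both come from this inequality. *)
have vlt x z : v (x + z) <= v x + (u (y x + z) - u (y x)).
  rewrite /v; apply: (le_trans (y2 _ (y x + z))); rewrite /F opprD addrACA subrr addr0.
  by lra.
have e2 : 0 < 2 * e by rewrite mulr_gt0.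
exists v; split.
- have h x z : v z - v x <= L * `|x - z|.
    have := vlt x (z - x); rewrite addrC subrK => h.
    have := uL (y x + (z - x)) (y x); rewrite addrAC subrr add0r => /(le_trans (ler_norm _)).
    by rewrite -[`|z - x|]normrN opprB; lra.
  by move=> x z; rewrite ler_norml; have := h x z; have := h z x; rewrite (distrC z x); lra.
- move=> x.
  have h1 : v x <= u x.
    by apply: (le_trans (y2 x x)); rewrite /F subrr sqnorm0 mul0r addr0.
  have h2 : u x <= v x + L * (2 * e * L).
    have := le_trans (ler_norm _) (uL x (y x)) => h.
    have : L * `|x - y x| <= L * (2 * e * L) by rewrite ler_wpM2l.
    have : 0 <= sqnorm (x - y x) / (2 * e) by rewrite divr_ge0 ?sqnorm_ge0// ltW.
    by rewrite /v /F; lra.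
  by rewrite ler_norml; apply/andP; split; lra.
- move=> x z.
  (* Semiconcavity: the same competitor [y x] is used at [x + z] and at [x - z], and the
     parallelogram identity evaluates the two parabola terms. *)
  have h1 := y2 (x + z) (y x); have h2 := y2 (x - z) (y x).
  have := sqnorm_parallelogram (x - y x) z.
  rewrite (addrAC x (- y x) z) (addrAC x (- y x) (- z)) => E.
  have E2 : sqnorm (x + z - y x) / (2 * e) + sqnorm (x - z - y x) / (2 * e) =
      2 * (sqnorm (x - y x) / (2 * e)) + sqnorm z / e.
    by rewrite -mulrDl E; field; rewrite gt_eqF.
  by move: h1 h2 E2; rewrite /v /F; lra.
- by move=> x; exists (y x) => // z; have := vlt x z; lra.
Qed.

End sqnorm.

(** * Energy form and weak inequality *)

Section Rintegral_extra.
Context d (T : measurableType d) (R : realType) (mu : {measure set T -> \bar R}).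
Implicit Types (D : set T) (f g : T -> R).

Lemma EFin_Rintegral D f : measurable D -> mu.-integrable D (EFin \o f) ->
  (\int[mu]_(x in D) (f x)%:E)%E = (\int[mu]_(x in D) f x)%:E.
Proof. by move=> mD fi; rewrite fineK//; exact: integrable_fin_num. Qed.

Lemma le_integrable_real D f g : measurable D -> measurable_fun D f ->
  (forall x, D x -> `|f x| <= g x) -> mu.-integrable D (EFin \o g) ->
  mu.-integrable D (EFin \o f).
Proof.
move=> mD mf fg gi; apply: (le_integrable mD _ _ gi); first exact/measurable_EFinP.
by move=> x Dx /=; rewrite lee_fin (le_trans (fg _ Dx))// ler_norm.
Qed.

Lemma ge0_integrable D f : measurable_fun D f -> (forall x, D x -> 0 <= f x) ->
  (\int[mu]_(x in D) (f x)%:E < +oo)%E -> mu.-integrable D (EFin \o f).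
Proof.
move=> mf f0 fi; apply/integrableP; split; first exact/measurable_EFinP.
rewrite (eq_integral (fun x => (f x)%:E))// => x /[!inE] Dx /=.
by rewrite ger0_norm// f0.
Qed.

(** Meant for [g] an inner integral in Tonelli's theorem, not yet known to have a finite
    integral. *)
Lemma le_Rintegral_integral D f (g : T -> \bar R) :
  measurable D -> mu.-integrable D (EFin \o f) -> measurable_fun D g ->
  (forall x, D x -> 0 <= g x)%E -> (forall x, D x -> (f x)%:E <= g x)%E ->
  ((\int[mu]_(x in D) f x)%:E <= \int[mu]_(x in D) g x)%E.
Proof.
move=> mD fi mg g0 fg; rewrite -EFin_Rintegral//.
have [goo|goo] := eqVneq (\int[mu]_(x in D) g x)%E +oo%E; first by rewrite goo leey.
apply: le_integral => //; last by move=> x /[!inE]; exact: fg.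
apply/integrableP; split => //.
rewrite (eq_integral g) ?ltey// => x /[!inE] Dx; rewrite gee0_abs//; exact: g0.
Qed.

Lemma integrableZ_real D f (k : R) : measurable D ->
  mu.-integrable D (EFin \o f) -> mu.-integrable D (EFin \o (fun x => k * f x)).
Proof. by move=> mD /(integrableZl mD k). Qed.

Lemma integrableD_real D f g : measurable D ->
  mu.-integrable D (EFin \o f) -> mu.-integrable D (EFin \o g) ->
  mu.-integrable D (EFin \o (fun x => f x + g x)).
Proof. by move=> mD fi gi; have := integrableD mD fi gi. Qed.

Lemma integrableB_real D f g : measurable D ->
  mu.-integrable D (EFin \o f) -> mu.-integrable D (EFin \o g) ->
  mu.-integrable D (EFin \o (fun x => f x - g x)).
Proof. by move=> mD fi gi; have := integrableB mD fi gi. Qed.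

End Rintegral_extra.

Section rV_integral.
Context {R : realType} {n : nat}.
Local Notation la := (lebesgue_rV R n).
Implicit Types (x y w : 'rV[R]_n) (f g v : 'rV[R]_n -> R).

Lemma integral_rV_shift (a : 'rV[R]_n) (f : 'rV[R]_n -> \bar R) : measurable_fun setT f ->
  (\int[la]_x f (x + a)%R = \int[la]_x f x)%E.
Proof.
move=> mf; rewrite -(@integral_rV_affine _ _ 1 a f)//; last by left.
by apply: eq_integral => x _; rewrite scale1r.
Qed.

Lemma integral_rV_opp (f : 'rV[R]_n -> \bar R) : measurable_fun setT f ->
  (\int[la]_x f (- x)%R = \int[la]_x f x)%E.
Proof.
move=> mf; rewrite -(@integral_rV_affine _ _ (-1) 0 f)//; last by right.
by apply: eq_integral => x _; rewrite scaleN1r addr0.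
Qed.

Lemma Rintegral_rV_shift a f : measurable_fun setT f ->
  \int[la]_x f (x + a) = \int[la]_x f x.
Proof. by move=> mf; congr fine; apply: (@integral_rV_shift a (EFin \o f));
  exact/measurable_EFinP. Qed.

Lemma measurable_rV_add : measurable_fun setT (fun p : 'rV[R]_n * 'rV[R]_n => p.1 + p.2).
Proof.
apply: measurable_fun_coordP => j.
apply: (eq_measurable_fun (fun p : 'rV[R]_n * 'rV[R]_n =>
   (p.1 ord0 j : measurableTypeR R) + p.2 ord0 j)).
  by move=> x _; rewrite !mxE.
apply: measurable_funD.
  exact: (measurableT_comp (measurable_coord j) measurable_fst).
exact: (measurableT_comp (measurable_coord j) measurable_snd).
Qed.

Lemma measurable_rV_opp : measurable_fun setT (fun x : 'rV[R]_n => - x).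
Proof.
apply: (eq_measurable_fun (fun x : 'rV[R]_n => -1 *: x + 0)).
  by move=> x _; rewrite scaleN1r addr0.
exact: measurable_rV_affine.
Qed.

Lemma continuous_comp_shift g a : continuous g -> continuous (fun x => g (x + a)).
Proof.
move=> cg x; apply: (@continuous_comp _ _ _ (fun x => x + a) g); last exact: cg.
by apply: (@continuousD _ _ _ id (fun=> a)) => //; exact: cst_continuous.
Qed.

Definition bounded_support (rho : R) g := forall x, rho < `|x| -> g x = 0.

Lemma continuous_bounded_support g rho : continuous g -> bounded_support rho g ->
  exists2 M, 0 <= M & forall x, `|g x| <= M.
Proof.
move=> cg gs; have [rho0|rho0] := ltP rho 0.
  by exists 0 => // x; rewrite gs ?normr0// (lt_le_trans rho0).
have B0 : [set y : 'rV[R]_n | `|0 - y| <= rho] 0 by rewrite /= subrr normr0.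
have [|y yB ymax] := @EVT_max_rV R n (fun x => `|g x|) _ (ex_intro _ _ B0)
  (@compact_ball _ _ 0 rho).
  by apply: continuous_subspaceT => z; apply: (@continuous_comp _ _ _ g);
    [exact: cg|exact: norm_continuous].
exists `|g y| => // x; have [xr|xr] := leP `|x| rho; last by rewrite gs ?normr0.
by apply: ymax; rewrite inE /= sub0r normrN.
Qed.

Lemma integrable_indic_box (r : R) : 0 <= r ->
  la.-integrable setT (EFin \o (\1_(box n r) : 'rV[R]_n -> R)).
Proof.
move=> r0; apply: ge0_integrable => [|x _|]; last 2 first.
- by rewrite indicE.
- by rewrite integral_indic ?setIT//= ?lebesgue_rV_box ?ltry//; exact: measurable_box.
by apply: measurable_indic; exact: measurable_box.
Qed.

Lemma Rintegral_indic_box (r : R) : 0 <= r ->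
  \int[la]_x (\1_(box n r) x : R) = (2 * r) ^+ n.
Proof.
move=> r0; rewrite /Rintegral integral_indic ?setIT//=; last exact: measurable_box.
by rewrite lebesgue_rV_box.
Qed.

Lemma integrable_bounded_support g M rho : measurable_fun setT g ->
  (forall x, `|g x| <= M) -> bounded_support rho g ->
  la.-integrable setT (EFin \o g).
Proof.
move=> mg gM gs.
apply: (le_integrable_real (g := fun x => M * \1_(box n `|rho|) x)) => //.
  move=> x _; have [xr|xr] := leP `|x| `|rho|.
    by rewrite indicE mem_set//= mulr1.
  have -> : g x = 0 by apply: gs; apply: le_lt_trans xr; exact: ler_norm.
  rewrite normr0 indicE memNset ?mulr0//.
  by rewrite /box /=; apply/negP; rewrite -ltNge.
by apply: integrableZ_real => //; exact: integrable_indic_box.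
Qed.

Lemma integrable_continuous g rho : continuous g -> bounded_support rho g ->
  la.-integrable setT (EFin \o g).
Proof.
move=> cg gs; have [M _ gM] := continuous_bounded_support cg gs.
by apply: integrable_bounded_support gM gs; exact: continuous_measurable_rV.
Qed.

(** The part of the bilinear form of [v] and [g] carried by the increment [w]; its integral against
    [K w] is the double integral of the weak form. *)
Definition energy_form v g w := \int[la]_x ((v (x + w) - v x) * (g (x + w) - g x)).

Lemma continuous_subr f g : continuous f -> continuous g -> continuous (fun x => f x - g x).
Proof. by move=> cf cg x; apply: (@continuousB _ _ _ f g); [exact: cf|exact: cg]. Qed.

Lemma continuous_mulr f g : continuous f -> continuous g -> continuous (fun x => f x * g x).
Proof. by move=> cf cg x; apply: (@continuousM _ _ f g); [exact: cf|exact: cg]. Qed.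

Lemma bounded_support_shift rho g w : bounded_support rho g ->
  bounded_support (rho + `|w|) (fun x => g (x + w)).
Proof.
move=> gs x; rewrite -ltrBrDr => h; apply: gs; apply: (lt_le_trans h).
by rewrite lerBlDr -{1}[x](addrK w) (le_trans (ler_normB _ _)).
Qed.

Lemma bounded_supportW rho r g : rho <= r -> bounded_support rho g -> bounded_support r g.
Proof. by move=> h gs x hx; apply: gs; exact: le_lt_trans hx. Qed.

Lemma bounded_supportMr rho f g : bounded_support rho g ->
  bounded_support rho (fun x => f x * g x).
Proof. by move=> gs x hx; rewrite gs// mulr0. Qed.

Lemma bounded_supportMl rho f g : bounded_support rho g ->
  bounded_support rho (fun x => g x * f x).
Proof. by move=> gs x hx; rewrite gs// mul0r. Qed.

Lemma bounded_supportB rho f g : bounded_support rho f -> bounded_support rho g ->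
  bounded_support rho (fun x => f x - g x).
Proof. by move=> fs gs x hx; rewrite fs// gs// subr0. Qed.

Lemma integrable_energy_form v g w rho : continuous v -> continuous g ->
  bounded_support rho g ->
  la.-integrable setT (EFin \o (fun x => (v (x + w) - v x) * (g (x + w) - g x))).
Proof.
move=> cv cg gs; apply: (integrable_continuous (rho := rho + `|w|)).
  by apply: continuous_mulr; apply: continuous_subr => //; exact: continuous_comp_shift.
apply: bounded_supportMr; apply: bounded_supportB; first exact: bounded_support_shift.
by apply: bounded_supportW gs; rewrite lerDl.
Qed.

(** Discrete integration by parts: translating the backward difference by [w] moves the difference
    onto [g]. *)
Lemma energy_form_second_difference v g w rho :
  continuous v -> continuous g -> bounded_support rho g ->
  \int[la]_x (g x * (2 * v x - v (x + w) - v (x - w))) = energy_form v g w.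
Proof.
move=> cv cg gs.
have c1 z : continuous (fun x => g x * (v x - v (x + z))).
  by apply: continuous_mulr => //; apply: continuous_subr => //; exact: continuous_comp_shift.
have i1 z : la.-integrable setT (EFin \o (fun x => g x * (v x - v (x + z)))).
  by apply: (integrable_continuous (rho := rho)) => //; exact: bounded_supportMl.
transitivity (\int[la]_x (g x * (v x - v (x + w))) + \int[la]_x (g x * (v x - v (x - w)))).
  by rewrite -RintegralD//; apply: eq_Rintegral => x _; ring.
rewrite -[X in _ + X](Rintegral_rV_shift w); last exact: continuous_measurable_rV.
rewrite -RintegralD//; last first.
  apply: (integrable_continuous (rho := rho + `|w|)).
    exact: (continuous_comp_shift (g := fun x => g x * (v x - v (x - w)))).
  by apply: (bounded_support_shift (g := fun x => g x * (v x - v (x - w))));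
    exact: bounded_supportMl.
by apply: eq_Rintegral => x _; rewrite addrK; ring.
Qed.

End rV_integral.

Section energy_form_bounds.
Context {R : realType} {n : nat}.
Local Notation la := (lebesgue_rV R n).
Implicit Types (rho A L Lg : R) (x y w : 'rV[R]_n) (f g v : 'rV[R]_n -> R).

Lemma measurable_rV_shift w : measurable_fun setT (fun x : 'rV[R]_n => x + w).
Proof.
apply: (eq_measurable_fun (fun x : 'rV[R]_n => 1 *: x + w)).
  by move=> x _; rewrite scale1r.
exact: measurable_rV_affine.
Qed.

(** The integrand vanishes unless [x] or [x + w] lies in the box of volume [(2 * rho) ^ n], whence
    the factor [2]. The bound [A] on the increments of [v] is kept separate: [A = L * |w|] yields
    the dominating function, and a small [A] yields convergence. *)
Lemma energy_form_bound v g w rho Lg A : 0 <= rho -> 0 <= Lg ->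
  continuous v -> (forall x y, `|g x - g y| <= Lg * `|x - y|) ->
  bounded_support rho g -> (forall x, `|v (x + w) - v x| <= A) ->
  `|energy_form v g w| <= A * (Lg * `|w| * (2 * (2 * rho) ^+ n)).
Proof.
move=> rho0 Lg0 cv gL gs vA.
have cg := continuous_of_lipschitz gL.
have A0 : 0 <= A := le_trans (normr_ge0 _) (vA 0).
have ib := @integrable_indic_box R n _ rho0.
have m1 : measurable_fun setT (\1_(box n rho) : 'rV[R]_n -> R).
  by apply: measurable_indic; exact: measurable_box.
have ibw : la.-integrable setT (EFin \o (fun x => \1_(box n rho) (x + w) : R)).
  apply: ge0_integrable => [|x _|].
  - exact: (measurableT_comp m1 (measurable_rV_shift w)).
  - by rewrite indicE.
  - rewrite (@integral_rV_shift _ _ w (EFin \o \1_(box n rho))).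
      by rewrite integral_indic ?setIT//= ?lebesgue_rV_box ?ltry//; exact: measurable_box.
    by apply/measurable_EFinP/measurable_indic; exact: measurable_box.
apply: (le_trans (le_normr_Rintegral measurableT (integrable_energy_form w cv cg gs))).
pose C := A * (Lg * `|w|).
apply: (@le_trans _ _ (\int[la]_x (C * (\1_(box n rho) x + \1_(box n rho) (x + w))))).
  apply: le_Rintegral => //.
  - by have := integrable_norm (integrable_energy_form w cv cg gs).
  - by apply: integrableZ_real => //; exact: integrableD_real.
  move=> x _; rewrite normrM /C -mulrA ler_pM//.
  have [h1|h1] := leP `|x| rho.
    rewrite [X in _ * (X + _)]indicE mem_set//= mulrDr mulr1.
    apply: (@le_trans _ _ (Lg * `|w|));
      first by rewrite (le_trans (gL _ _))// addrAC subrr add0r.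
    by rewrite lerDl mulr_ge0// ?mulr_ge0// indicE.
  have [h2|h2] := leP `|x + w| rho.
    rewrite [X in _ * (_ + X)]indicE mem_set//= mulrDr mulr1.
    apply: (@le_trans _ _ (Lg * `|w|));
      first by rewrite (le_trans (gL _ _))// addrAC subrr add0r.
    by rewrite lerDr mulr_ge0// ?mulr_ge0// indicE.
  by rewrite !gs// subrr normr0 mulr_ge0// ?mulr_ge0// addr_ge0// indicE.
rewrite RintegralZl//; last exact: integrableD_real.
rewrite RintegralD//.
rewrite (Rintegral_rV_shift w (f := \1_(box n rho))); last by apply: measurable_indic;
  exact: measurable_box.
by rewrite Rintegral_indic_box// /C le_eqVlt; apply/orP; left; apply/eqP; ring.
Qed.

Lemma measurable_Rintegral_param (F : 'rV[R]_n * 'rV[R]_n -> R) :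
  measurable_fun setT F -> measurable_fun setT (fun w => \int[la]_x F (x, w)).
Proof.
move=> mF; apply: measurableT_comp; first exact: fine_measurable.
apply: (eq_measurable_fun (fun w => \int[la]_x ((EFin \o F)^\+ (x, w)) -
   \int[la]_x ((EFin \o F)^\- (x, w)))%E).
  move=> w _; rewrite [RHS]integralE; congr (_ - _)%E.
  - by apply: eq_integral => x _; rewrite !funeposE.
  - by apply: eq_integral => x _; rewrite !funenegE.
apply: emeasurable_funB.
- apply: (@measurable_fun_fubini_tonelli_G _ _ _ _ _ la ((EFin \o F)^\+)%E) => //.
  by apply: measurable_funepos; exact/measurable_EFinP.
- apply: (@measurable_fun_fubini_tonelli_G _ _ _ _ _ la ((EFin \o F)^\-)%E) => //.
  by apply: measurable_funeneg; exact/measurable_EFinP.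
Qed.

Lemma measurable_comp_fst g : measurable_fun setT g ->
  measurable_fun setT (fun p : 'rV[R]_n * 'rV[R]_n => g p.1).
Proof. by move=> mg; apply: (measurableT_comp mg); exact: measurable_fst. Qed.

Lemma measurable_comp_snd g : measurable_fun setT g ->
  measurable_fun setT (fun p : 'rV[R]_n * 'rV[R]_n => g p.2).
Proof. by move=> mg; apply: (measurableT_comp mg); exact: measurable_snd. Qed.

Lemma measurable_comp_add g : measurable_fun setT g ->
  measurable_fun setT (fun p : 'rV[R]_n * 'rV[R]_n => g (p.1 + p.2)).
Proof. by move=> mg; apply: (measurableT_comp mg); exact: measurable_rV_add. Qed.

Lemma measurable_comp_sub g : measurable_fun setT g ->
  measurable_fun setT (fun p : 'rV[R]_n * 'rV[R]_n => g (p.1 - p.2)).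
Proof.
move=> mg; apply: (measurableT_comp mg).
apply: (measurableT_comp measurable_rV_add (g := fun p : 'rV[R]_n * 'rV[R]_n => (p.1, - p.2))).
apply: measurable_fun_pair => //.
by apply: (measurableT_comp measurable_rV_opp); exact: measurable_snd.
Qed.

Lemma measurable_diff v : measurable_fun setT v ->
  measurable_fun setT (fun p : 'rV[R]_n * 'rV[R]_n => v (p.1 + p.2) - v p.1).
Proof.
move=> mv; apply: measurable_funB; [exact: measurable_comp_add|exact: measurable_comp_fst].
Qed.

Lemma measurable_energy_form v g : continuous v -> continuous g ->
  measurable_fun setT (energy_form v g).
Proof.
move=> cv cg; apply: (measurable_Rintegral_param
  (F := fun p => (v (p.1 + p.2) - v p.1) * (g (p.1 + p.2) - g p.1))).
by apply: measurable_funM; apply: measurable_diff; exact: continuous_measurable_rV.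
Qed.

End energy_form_bounds.

Section kernel.
Context {R : realType} {n : nat}.
Local Notation la := (lebesgue_rV R n).
Implicit Types (rho A L Lg : R) (x y w : 'rV[R]_n) (f g v u : 'rV[R]_n -> R).
Variable K : 'rV[R]_n -> R.
Hypothesis K0 : forall w, 0 <= K w.
Hypothesis mK : measurable_fun setT K.
Hypothesis eK : even_fun K.
Hypothesis iK : la.-integrable setT (EFin \o (fun w => sqnorm w * K w)).

(** Two Lipschitz increments make the integrand quadratic in [w]. The dominating function in the
    second conjunct depends on [v] only through [L], so it serves a whole sequence of
    inf-convolutions. *)
Lemma integrable_kernel_energy_form v g L Lg rho : 0 <= rho -> 0 <= L -> 0 <= Lg ->
  (forall x y, `|v x - v y| <= L * `|x - y|) ->
  (forall x y, `|g x - g y| <= Lg * `|x - y|) -> bounded_support rho g ->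
  la.-integrable setT (EFin \o (fun w => K w * energy_form v g w)) /\
  forall w, `|K w * energy_form v g w| <= L * Lg * (2 * (2 * rho) ^+ n) * (sqnorm w * K w).
Proof.
move=> rho0 L0 Lg0 vL gL gs.
have H w : `|K w * energy_form v g w| <= L * Lg * (2 * (2 * rho) ^+ n) * (sqnorm w * K w).
  rewrite normrM ger0_norm// mulrA mulrC ler_wpM2r//.
  apply: le_trans (energy_form_bound (A := L * `|w|) rho0 Lg0 (continuous_of_lipschitz vL)
    gL gs _) _.
    by move=> x; rewrite (le_trans (vL _ _))// addrAC subrr add0r.
  rewrite (_ : L * `|w| * _ = L * Lg * (2 * (2 * rho) ^+ n) * `|w| ^+ 2); last by ring.
  by rewrite ler_wpM2l ?norm_le_sqnorm// !mulr_ge0// exprn_ge0// mulr_ge0.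
split => //; apply: (le_integrable_real _ _ _ (integrableZ_real _ _ iK)) => //.
  by apply: measurable_funM => //; apply: measurable_energy_form;
    apply: continuous_of_lipschitz; eassumption.
Qed.

(** The principal value after the substitution [z = x + w], with truncations centred at the
    origin. *)
Definition principal_value u f := forall x,
  (\int[la]_(w in ~` eball 0 r) ((u x - u (x + w)) * K w)%:E)%E @[r --> 0^'+] --> (f x)%:E.

Lemma measurable_eballC (r : R) : measurable (~` eball (0 : 'rV[R]_n) r).
Proof.
apply: measurableC.
have cs : continuous (fun w : 'rV[R]_n => enorm w).
  by move=> w; apply: (@continuous_comp _ _ _ (@sqnorm R n));
    [exact: continuous_sqnorm|exact: sqrt_continuous].
have := continuous_measurable_rV cs measurableT (measurable_itv `]-oo, r[%R).
by rewrite setTI; congr measurable; apply/seteqP; split => x; rewrite /eball /= in_itv/= subr0.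
Qed.

End kernel.

Section weak.
Context {R : realType} {n : nat}.
Local Notation la := (lebesgue_rV R n).
Implicit Types (rho A L Lg e r : R) (x y w : 'rV[R]_n) (f g v u : 'rV[R]_n -> R).
Variable K : 'rV[R]_n -> R.
Hypothesis K0 : forall w, 0 <= K w.
Hypothesis mK : measurable_fun setT K.
Hypothesis eK : even_fun K.
Hypothesis iK : la.-integrable setT (EFin \o (fun w => sqnorm w * K w)).

Let D (k : nat) : set 'rV[R]_n := ~` eball 0 k.+1%:R^-1.

Let mD k : measurable (D k). Proof. exact: measurable_eballC. Qed.

Let DN k w : D k (- w) <-> D k w.
Proof.
rewrite /D /eball /= !subr0 /enorm.
by under eq_bigr do rewrite mxE sqrrN.
Qed.

Let D_sub k l : (k <= l)%N -> D k `<=` D l.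
Proof.
move=> kl w /=; rewrite /D /eball /=; apply: contra_not => h; apply: (lt_le_trans h).
by rewrite lef_pV2 ?posrE// ler_nat.
Qed.

Let D_cover w : w != 0 -> exists k, D k w.
Proof.
move=> w0; have ew : 0 < enorm w by rewrite (lt_le_trans _ (norm_le_enorm w))// normr_gt0.
have [k _ hk] := near_infty_natSinv_lt (PosNum ew).
exists k; rewrite /D /eball /= subr0; apply/negP; rewrite -leNgt ltW//.
exact: (hk k (leqnn k)).
Qed.

(** Outside the ball of radius [r] one has [|w| <= sqnorm w / r], so the second moment controls
    first-order increments. The sign [s] covers both [x + w] and [x - w]. *)
Lemma integrable_eballC v x L r (s : R) : 0 < r -> `|s| = 1 -> 0 <= L ->
  (forall x y, `|v x - v y| <= L * `|x - y|) ->
  la.-integrable (~` eball 0 r) (EFin \o (fun w => (v x - v (x + s *: w)) * K w)).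
Proof.
move=> r0 s1 L0 vL; have mr := @measurable_eballC R n r.
apply: (le_integrable_real (g := fun w => (L / r) * (sqnorm w * K w)) mr).
- apply: measurable_funTS; apply: measurable_funM => //; apply: measurable_funB => //.
  apply: (eq_measurable_fun (fun w => v (s *: w + x))); first by move=> w _; rewrite addrC.
  apply: (measurableT_comp (continuous_measurable_rV (continuous_of_lipschitz vL))).
  exact: measurable_rV_affine.
- move=> w Dw; rewrite normrM (ger0_norm (K0 w)) mulrA ler_wpM2r//.
  rewrite (le_trans (vL _ _))// opprD addrA subrr sub0r normrN normrZ s1 mul1r -mulrA
    ler_wpM2l//.
  have ew : r <= enorm w by move: Dw; rewrite /eball /= subr0 => /negP; rewrite -leNgt.
  rewrite -enorm_sq expr2 mulrA (le_trans (norm_le_enorm w))// ler_peMl ?enorm_ge0//.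
  by rewrite mulrC ler_pdivlMr// mul1r.
- by apply: integrableZ_real => //; apply: integrableS iK.
Qed.

Let integrable_D v x L k (s : R) : `|s| = 1 -> 0 <= L ->
  (forall x y, `|v x - v y| <= L * `|x - y|) ->
  la.-integrable (D k) (EFin \o (fun w => (v x - v (x + s *: w)) * K w)).
Proof. by move=> s1 L0 vL; apply: (integrable_eballC _ _ s1 L0 vL); rewrite invr_gt0. Qed.

Lemma principal_value_opp u f L : 0 <= L -> (forall x y, `|u x - u y| <= L * `|x - y|) ->
  principal_value K u f -> principal_value K (fun x => - u x) (fun x => - f x).
Proof.
move=> L0 uL upv x; rewrite EFinN; apply: cvg_trans (cvgeN (upv x)).
apply: near_eq_cvg; near=> r.
have r0 : 0 < r by near: r; exact: nbhs_right_gt.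
have i1 : la.-integrable (~` eball 0 r) (EFin \o (fun w => (u x - u (x + w)) * K w)).
  have := integrable_eballC x r0 (normr1 _) L0 uL.
  by under eq_fun do rewrite /= scale1r.
rewrite /= -mulN1e -(integralZl (measurable_eballC r) i1 (-1)).
by apply: eq_integral => w _; rewrite /= -EFinM; congr EFin; ring.
Unshelve. all: by end_near. Qed.

Let Rintegral_D_reflect g k : measurable_fun setT g ->
  \int[la]_(w in D k) g (- w) = \int[la]_(w in D k) g w.
Proof.
move=> mg; rewrite Rintegral_mkcond [RHS]Rintegral_mkcond; congr fine.
rewrite -(@integral_rV_opp _ _ (EFin \o (g \_ (D k)))).
  apply: eq_integral => w _; rewrite /= !patchE; congr EFin.
  have -> : (- w \in D k) = (w \in D k) by apply/idP/idP => /set_mem h; apply/mem_set/DN;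
    rewrite ?opprK.
  by [].
apply/measurable_EFinP; apply/(measurable_restrict _ (mD k) measurableT).
exact: measurable_funTS.
Qed.

Let cvg_D_moment : \int[la]_(w in D k) (sqnorm w * K w) @[k --> \oo] --> \int[la]_w
  (sqnorm w * K w).
Proof.
apply: fine_cvg; rewrite -EFin_Rintegral//.
have mq : measurable_fun setT (fun w => (sqnorm w * K w)%:E).
  by case/integrableP : iK.
rewrite (_ : (\int[la]_w (sqnorm w * K w)%:E)%E =
  (\int[la]_(w in \bigcup_k D k) (sqnorm w * K w)%:E)%E); last first.
  rewrite [RHS]integral_mkcond; apply: eq_integral => w _; rewrite patchE.
  (* The truncation domains miss only the origin, where [sqnorm] vanishes. *)
  have [->|w0] := eqVneq w 0; first by rewrite sqnorm0 mul0r; case: ifP.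
  by rewrite mem_set//; have [k Dk] := D_cover w0; exists k.
apply: ge0_nondecreasing_set_cvg_integral => //.
- by move=> k l kl; apply/subsetPset; exact: D_sub.
- by move=> k; exact: measurable_funTS.
- by move=> k w _; rewrite lee_fin mulr_ge0// sqnorm_ge0.
Qed.

(** On a truncated domain, evenness of [K] folds the second difference of [v] into twice a first
    difference, which [u] at the contact point [y] bounds below. The term [sqnorm w / e] makes the
    integrand nonnegative, so truncated integrals stay below the full one, and only those of [u]
    have to converge. *)
Lemma second_difference_lower v u f x y e L : 0 < e -> 0 <= L ->
  (forall x y, `|v x - v y| <= L * `|x - y|) ->
  (forall x y, `|u x - u y| <= L * `|x - y|) ->
  (forall w, v (x + w) + v (x - w) - 2 * v x <= sqnorm w / e) ->
  (forall w, u y - u (y + w) <= v x - v (x + w)) -> principal_value K u f ->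
  ((2 * f y + (\int[la]_w (sqnorm w * K w)) / e)%:E <=
   \int[la]_w ((2 * v x - v (x + w) - v (x - w) + sqnorm w / e) * K w)%:E)%E.
Proof.
move=> e0 L0 vL uL sc below upv.
pose S w := (2 * v x - v (x + w) - v (x - w) + sqnorm w / e) * K w.
have S0 w : 0 <= S w by rewrite /S mulr_ge0//; have := sc w; lra.
have cv := continuous_of_lipschitz vL.
have mvp (s : R) : measurable_fun setT (fun w => v (x + s *: w)).
  apply: (eq_measurable_fun (fun w => v (s *: w + x))); first by move=> w _; rewrite addrC.
  apply: (measurableT_comp (continuous_measurable_rV cv)).
  exact: measurable_rV_affine.
have mq : measurable_fun setT (@sqnorm R n).
  by apply: continuous_measurable_rV; exact: continuous_sqnorm.
have mS : measurable_fun setT S.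
  apply: measurable_funM => //; apply: measurable_funD; last exact: measurable_funM.
  apply: (eq_measurable_fun (fun w => 2 * v x - v (x + 1 *: w) - v (x + -1 *: w))).
    by move=> w _; rewrite scale1r scaleN1r.
  by apply: measurable_funB => //; apply: measurable_funB.
have [->|Soo] := eqVneq (\int[la]_w (S w)%:E)%E +oo%E; first by rewrite leey.
have iS : la.-integrable setT (EFin \o S).
  by apply: ge0_integrable => //; rewrite ltey.
rewrite EFin_Rintegral// lee_fin.
have step k : 2 * \int[la]_(w in D k) ((u y - u (y + w)) * K w) +
    (\int[la]_(w in D k) (sqnorm w * K w)) / e <= \int[la]_w S w.
  have iv s : `|s| = 1 -> la.-integrable (D k)
    (EFin \o (fun w => (v x - v (x + s *: w)) * K w)).
    by move=> s1; apply: integrable_D vL.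
  have iv1 : la.-integrable (D k) (EFin \o (fun w => (v x - v (x + w)) * K w)).
    by have := iv 1 (normr1 _); under eq_fun do rewrite /= scale1r.
  have ivN : la.-integrable (D k) (EFin \o (fun w => (v x - v (x - w)) * K w)).
    have := iv (-1); rewrite normrN normr1 => /(_ erefl).
    by under eq_fun do rewrite /= scaleN1r.
  have iu1 : la.-integrable (D k) (EFin \o (fun w => (u y - u (y + w)) * K w)).
    by have := @integrable_D u y L k 1 (normr1 _) L0 uL; under eq_fun do rewrite /= scale1r.
  have iq : la.-integrable (D k) (EFin \o (fun w => sqnorm w * K w)) by apply: integrableS iK.
  apply: (@le_trans _ _ (\int[la]_(w in D k) S w)); last first.
    rewrite -lee_fin -!EFin_Rintegral//; last exact: integrableS iS.
    apply: ge0_subset_integral => //; first exact/measurable_EFinP.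
    by move=> w _; rewrite lee_fin.
  have -> : \int[la]_(w in D k) S w = \int[la]_(w in D k) ((v x - v (x + w)) * K w) +
      \int[la]_(w in D k) ((v x - v (x - w)) * K w) +
        e^-1 * \int[la]_(w in D k) (sqnorm w * K w).
    rewrite -RintegralD// -RintegralZl// -RintegralD//.
    - by apply: eq_Rintegral => w _; rewrite /S; ring.
    - exact: integrableD_real.
    - exact: integrableZ_real.
  have -> : \int[la]_(w in D k) ((v x - v (x - w)) * K w) =
    \int[la]_(w in D k) ((v x - v (x + w)) * K w).
    rewrite -(Rintegral_D_reflect (g := fun w => (v x - v (x + w)) * K w)).
      by apply: eq_Rintegral => w _; rewrite eK.
    apply: measurable_funM => //; apply: measurable_funB => //.
    by have := mvp 1; under eq_fun do rewrite scale1r.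
  rewrite [e^-1 * _]mulrC lerD2r mulr_natl mulr2n lerD//;
    by apply: le_Rintegral => // w _; rewrite ler_wpM2r.
have cT : \int[la]_(w in D k) ((u y - u (y + w)) * K w) @[k --> \oo] --> f y.
  have /fine_cvg/cvg_at_rightP h := upv y.
  apply: (h (fun k => k.+1%:R^-1)); split => [k|]; first by rewrite invr_gt0.
  exact: cvg_harmonic.
apply: (@cvgr_to_le _ \oo _ _ (fun k => 2 * \int[la]_(w in D k) ((u y - u (y + w)) * K w) +
    (\int[la]_(w in D k) (sqnorm w * K w)) / e)).
  apply: cvgD; first by apply: cvgM => //; exact: cvg_cst.
  by apply: cvgM; [exact: cvg_D_moment|exact: cvg_cst].
by near=> k; exact: step.
Unshelve. all: by end_near. Qed.

End weak.

Section weak_limit.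
Context {R : realType} {n : nat}.
Local Notation la := (lebesgue_rV R n).
Implicit Types (rho A L Lg e r om : R) (x y w : 'rV[R]_n) (f g v u : 'rV[R]_n -> R).
Variable K : 'rV[R]_n -> R.
Hypothesis K0 : forall w, 0 <= K w.
Hypothesis mK : measurable_fun setT K.
Hypothesis eK : even_fun K.
Hypothesis iK : la.-integrable setT (EFin \o (fun w => sqnorm w * K w)).

(* Semiconcavity makes the integrand [F] below nonnegative, so Tonelli applies
   although the principal values need not converge uniformly: integrating in [w]
   first gives at least the right-hand side of the equation, integrating in [x]
   first gives the energy form. *)
Lemma weak_step u f g L Lg e rho om : 0 < e -> 0 <= L -> 0 <= Lg -> 0 <= rho ->
  (forall x y, `|u x - u y| <= L * `|x - y|) -> principal_value K u f -> continuous f ->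
  (forall x, 0 <= g x) -> (forall x y, `|g x - g y| <= Lg * `|x - y|) ->
  bounded_support rho g ->
  (forall x, `|x| <= rho -> forall y, `|x - y| <= 2 * e * L -> `|f x - f y| <= om) ->
  exists v, [/\ forall x y, `|v x - v y| <= L * `|x - y|,
     forall x, `|v x - u x| <= 2 * e * L ^+ 2 &
     2 * (\int[la]_x (g x * f x)) - 2 * om * \int[la]_x g x <=
     \int[la]_w (K w * energy_form v g w)].
Proof.
move=> e0 L0 Lg0 rho0 uL upv cf g0 gL gs fom.
have [v [vL vu sc below]] := inf_convolution e0 L0 uL.
exists v; split => //.
have cv := continuous_of_lipschitz vL; have cg := continuous_of_lipschitz gL.
have mv := continuous_measurable_rV cv; have mg := continuous_measurable_rV cg.
set Q := \int[la]_w (sqnorm w * K w).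
set Phi := \int[la]_x g x.
have ig : la.-integrable setT (EFin \o g) by exact: integrable_continuous gs.
have igf : la.-integrable setT (EFin \o (fun x => g x * f x)).
  by apply: (integrable_continuous (rho := rho));
    [exact: continuous_mulr|exact: bounded_supportMl].
have mq : measurable_fun setT (@sqnorm R n).
  by apply: continuous_measurable_rV; exact: continuous_sqnorm.
pose S x w := 2 * v x - v (x + w) - v (x - w) + sqnorm w / e.
have S0 x w : 0 <= S x w by rewrite /S; have := sc x w; lra.
have mS : measurable_fun setT (fun p : 'rV[R]_n * 'rV[R]_n => S p.1 p.2).
  apply: measurable_funD; last first.
    by apply: measurable_funM => //; exact: measurable_comp_snd.
  apply: measurable_funB; last exact: measurable_comp_sub.
  apply: measurable_funB; last exact: measurable_comp_add.
  by apply: measurable_funM => //; exact: measurable_comp_fst.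
pose F (p : 'rV[R]_n * 'rV[R]_n) := (g p.1 * (S p.1 p.2 * K p.2))%:E.
have F0 p : (0 <= F p)%E by rewrite lee_fin !mulr_ge0.
have mF : measurable_fun setT F.
  apply/measurable_EFinP; apply: measurable_funM; first exact: measurable_comp_fst.
  by apply: measurable_funM => //; exact: measurable_comp_snd.
(* The summand [Q / e * Phi] is the contribution of [sqnorm w / e], added for the sake of
   positivity; it reappears in [inner] and cancels there. *)
have outer_x : ((2 * (\int[la]_x (g x * f x)) - 2 * om * Phi + Q / e * Phi)%:E <=
    \int[la]_x \int[la]_w F (x, w))%E.
  have -> : 2 * (\int[la]_x (g x * f x)) - 2 * om * Phi + Q / e * Phi =
      \int[la]_x (2 * (g x * f x) + (Q / e - 2 * om) * g x).
    rewrite RintegralD//; [|exact: integrableZ_real|exact: integrableZ_real].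
    rewrite RintegralZl// RintegralZl// -/Phi. ring.
  apply: le_Rintegral_integral => //.
  - by apply: integrableD_real => //; exact: integrableZ_real.
  - exact: (measurable_fun_fubini_tonelli_F F mF F0).
  - by move=> x _; apply: integral_ge0.
  move=> x _; rewrite /F /=.
  have mSx : measurable_fun setT (fun w => (S x w * K w)%:E).
    apply/measurable_EFinP; apply: measurable_funM => //.
    by apply: (measurableT_comp mS (g := fun w => (x, w))); exact: measurable_fun_pair.
  under eq_integral do rewrite EFinM.
  rewrite ge0_integralZl//; first last.
  - by rewrite lee_fin.
  - by move=> w _; rewrite lee_fin mulr_ge0.
  (* Off the support of [g] both sides vanish; on it, the contact point [y] is near [x], and
     replacing [f y] by [f x] costs at most [om]. *)
  have [xr|xr] := leP `|x| rho; last by rewrite gs// !(mul0r,mulr0,addr0) mul0e.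
  have [y yx hy] := below x.
  apply: le_trans (lee_wpmul2l _
    (second_difference_lower K0 mK eK iK e0 L0 vL uL (sc x) hy upv)); last by rewrite lee_fin.
  rewrite -EFinM lee_fin -/Q.
  have -> : 2 * (g x * f x) + (Q / e - 2 * om) * g x = g x * (2 * (f x - om) + Q / e) by ring.
  rewrite ler_wpM2l// lerD2r ler_wpM2l//.
  by have := fom x xr y yx; rewrite ler_norml => /andP[]; lra.
have ikf := integrable_kernel_energy_form K0 mK iK rho0 L0 Lg0 vL gL gs.
have inner : (\int[la]_x \int[la]_w F (x, w) =
    (\int[la]_w (K w * energy_form v g w) + Q / e * Phi)%:E)%E.
  rewrite (fubini_tonelli F mF F0).
  have -> : \int[la]_w (K w * energy_form v g w) + Q / e * Phi =
      \int[la]_w (K w * energy_form v g w + (Phi / e) * (sqnorm w * K w)).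
    rewrite RintegralD//; [|exact: ikf.1|exact: integrableZ_real].
    by rewrite RintegralZl// -/Q; ring.
  rewrite -EFin_Rintegral//; last by apply: integrableD_real => //;
    [exact: ikf.1|exact: integrableZ_real].
  apply: eq_integral => w _; rewrite /F /=.
  have i1 : la.-integrable setT (EFin \o (fun x => g x * (2 * v x - v (x + w) - v (x - w)))).
    apply: (integrable_continuous (rho := rho)); last exact: bounded_supportMl.
    apply: continuous_mulr => //; apply: continuous_subr; last exact: continuous_comp_shift.
    apply: continuous_subr; last exact: continuous_comp_shift.
    by apply: continuous_mulr => // x; exact: cst_continuous.
  have E x : g x * (S x w * K w) =
    K w * (g x * (2 * v x - v (x + w) - v (x - w)) + (sqnorm w / e) * g x).
    by rewrite /S; ring.
  under eq_integral do rewrite E.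
  rewrite EFin_Rintegral//; last first.
    by apply: integrableZ_real => //; apply: integrableD_real => //; exact: integrableZ_real.
  rewrite RintegralZl//; last by apply: integrableD_real => //; exact: integrableZ_real.
  rewrite RintegralD//; last exact: integrableZ_real.
  rewrite RintegralZl// (energy_form_second_difference _ cv cg gs) -/Phi.
  by congr EFin; ring.
by move: outer_x; rewrite inner lee_fin lerD2r.
Qed.

(** Heine's argument by compactness of the ball; only [x] is confined to it, since the contact point
    [y] may leave it. *)
Lemma uniform_continuity_box f rho om : continuous f -> 0 < om ->
  exists2 d, 0 < d & forall x, `|x| <= rho -> forall y, `|x - y| <= d -> `|f x - f y| <= om.
Proof.
move=> cf om0.
have [d [d0 hd]] : exists d, 0 < d /\ [set y | `|0 - y| <= rho] `<=`
    (fun x => forall y, `|x - y| <= d -> `|f x - f y| <= om).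
  have /compact_near_coveringP := @compact_ball R n 0 rho.
  move=> /(_ R 0^'+ (fun d x => forall y, `|x - y| <= d -> `|f x - f y| <= om) _) h.
  have {h}h : \forall d \near 0^'+, [set y | `|0 - y| <= rho] `<=`
    (fun x => forall y, `|x - y| <= d -> `|f x - f y| <= om).
    apply: h => x _.
    have om2 : 0 < om / 2 by rewrite divr_gt0.
    have /nbhs_ballP[e /= e0 he] : nbhs x [set z | `|f x - f z| < om / 2].
      have := cf x; move=> /(@cvgrPdist_lt _ _ _ _ (nbhs_filter x)); exact.
    exists (ball x (e / 2), [set d | 0 < d < e / 2]).
      split => /=; first by apply: nbhsx_ballx; rewrite divr_gt0.
      near=> d; apply/andP; split; near: d; first exact: nbhs_right_gt.
      by apply: nbhs_right_lt; rewrite divr_gt0.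
    move=> [x' d] /= [bx' /andP[d0 de]] y xy.
    have e2 : e / 2 < e by lra.
    have h1 : `|f x - f x'| < om / 2.
      by apply: (he x'); move: bx'; rewrite -ball_normE /= => /lt_trans; apply.
    have h2 : `|f x - f y| < om / 2.
      apply: (he y); move: bx'; rewrite -!ball_normE /= => bx'.
      rewrite (le_lt_trans (ler_distD x' _ _))//; lra.
    have := ler_distD (f x) (f x') (f y); rewrite (distrC (f x') (f x)); lra.
  near (0 : R)^'+ => d; exists d; split; last by near: d.
  by near: d; exact: nbhs_right_gt.
by exists d => // x xr; apply: hd; rewrite /= sub0r normrN.
Unshelve. all: by end_near. Qed.

(** As [e] tends to [0], the inf-convolutions converge uniformly to [u] with the same Lipschitz
    constant: the energy forms converge at each [w] under a common dominating function. The error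
    [om] is arbitrary and is absorbed at the end. *)
Lemma weak_inequality u f g L Lg rho : 0 <= L -> 0 <= Lg -> 0 <= rho ->
  (forall x y, `|u x - u y| <= L * `|x - y|) -> principal_value K u f -> continuous f ->
  (forall x, 0 <= g x) -> (forall x y, `|g x - g y| <= Lg * `|x - y|) ->
  bounded_support rho g ->
  2 * (\int[la]_x (g x * f x)) <= \int[la]_w (K w * energy_form u g w).
Proof.
move=> L0 Lg0 rho0 uL upv cf g0 gL gs.
have cg := continuous_of_lipschitz gL; have cu := continuous_of_lipschitz uL.
set Phi := \int[la]_x g x.
have Phi0 : 0 <= Phi by apply: Rintegral_ge0.
suff H om : 0 < om -> 2 * (\int[la]_x (g x * f x)) - 2 * om * Phi <=
  \int[la]_w (K w * energy_form u g w).
  apply/ler_addgt0Pr => eps eps0.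
  have P1 : 0 < 2 * Phi + 1 by lra.
  have := H _ (divr_gt0 eps0 P1); rewrite lerBlDr => /le_trans; apply.
  rewrite lerD2l (_ : 2 * _ * Phi = eps * (2 * Phi / (2 * Phi + 1))); last by ring.
  by rewrite ler_piMr ?(ltW eps0)// ler_pdivrMr// mul1r; lra.
move=> om0.
have [d d0 hd] := uniform_continuity_box rho cf om0.
(* Starting at this [N], every [e = 1 / (N + k).+1] satisfies [2 * e * L <= d], so contact points
   stay within the modulus of continuity of [f]. *)
have [N hN] : exists N : nat, 2 * N.+1%:R^-1 * L <= d.
  have L1 : 0 < 2 * L + 1 by lra.
  have [N _ hN] := near_infty_natSinv_lt (PosNum (divr_gt0 d0 L1)).
  exists N; have /= := hN N (leqnn N); rewrite ltr_pdivlMr// => h.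
  apply: ltW; apply: le_lt_trans h.
  by rewrite mulrAC mulrC ler_wpM2l ?invr_ge0//; lra.
have Hk (k : nat) : exists v, [/\ forall x y, `|v x - v y| <= L * `|x - y|,
     forall x, `|v x - u x| <= 2 * (N + k).+1%:R^-1 * L ^+ 2 &
     2 * (\int[la]_x (g x * f x)) - 2 * om * \int[la]_x g x <=
     \int[la]_w (K w * energy_form v g w)].
  apply: (weak_step _ L0 Lg0 rho0 uL upv cf g0 gL gs); first by rewrite invr_gt0.
  move=> x xr y xy; apply: hd => //; apply: (le_trans xy); apply: le_trans hN.
  by rewrite ler_wpM2r// ler_wpM2l// lef_pV2 ?posrE// ler_nat ltnS leq_addr.
pose v k := sval (cid (Hk k)).
have [vL vu vI] : [/\ forall k x y, `|v k x - v k y| <= L * `|x - y|,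
     forall k x, `|v k x - u x| <= 2 * (N + k).+1%:R^-1 * L ^+ 2 &
     forall k, 2 * (\int[la]_x (g x * f x)) - 2 * om * \int[la]_x g x <=
     \int[la]_w (K w * energy_form (v k) g w)].
  by split => k; case: (svalP (cid (Hk k))).
have ikf k := integrable_kernel_energy_form K0 mK iK rho0 L0 Lg0 (vL k) gL gs.
have cvk k := continuous_of_lipschitz (vL k).
have pointwise w : K w * energy_form (v k) g w @[k --> \oo] --> K w * energy_form u g w.
  apply: cvgM; first exact: cvg_cst.
  (* Both endpoint values of [u - v k] are at most [2 * e * L ^ 2] in absolute value, so an
     increment is at most [4 * e * L ^ 2]. *)
  pose C := 4 * L ^+ 2 * (Lg * `|w| * (2 * (2 * rho) ^+ n)).
  have bound k : `|energy_form u g w - energy_form (v k) g w| <= C * (k + N).+1%:R^-1.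
    rewrite -RintegralB//; [|exact: integrable_energy_form gs|exact: integrable_energy_form gs].
    have cd : continuous (fun x => u x - v k x) by exact: continuous_subr.
    have := @energy_form_bound R n (fun x => u x - v k x) g w rho Lg
      (4 * (N + k).+1%:R^-1 * L ^+ 2) rho0 Lg0 cd gL gs.
    rewrite (_ : C * _ = 4 * (N + k).+1%:R^-1 * L ^+ 2
      * (Lg * `|w| * (2 * (2 * rho) ^+ n))); last first.
      by rewrite /C addnC; ring.
    move=> h; apply: le_trans (h _).
      rewrite le_eqVlt; apply/orP; left; apply/eqP; congr (`| _ |).
      by apply: eq_Rintegral => x _; ring.
    move=> x; have := vu k x; have := vu k (x + w).
    move: (_.+1%:R^-1) => a h1 h2.
    rewrite (_ : _ - _ = (v k x - u x) - (v k (x + w) - u (x + w))); last by ring.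
    by apply: (le_trans (ler_normB _ _)); lra.
  have cC : C * (k + N).+1%:R^-1 @[k --> \oo] --> 0.
    rewrite -(mulr0 C); apply: cvgM; first exact: cvg_cst.
    have := @cvg_harmonic R; rewrite -(cvg_shiftn N); exact.
  apply/cvgrPdist_le => eps eps0; near=> k.
  apply: (le_trans (bound k)); apply: (le_trans (ler_norm _)); rewrite -normrN -sub0r.
  by near: k; move/cvgrPdist_le : cC; exact.
have pointwiseE w : (EFin \o (fun w => K w * energy_form (v k) g w)) w @[k --> \oo] -->
    (EFin \o (fun w => K w * energy_form u g w)) w.
  apply: cvg_EFin; last exact: pointwise.
  exact: nearW.
have [iu _ cvI] := @dominated_convergence _ _ _ la setT measurableT
  (fun k => EFin \o (fun w => K w * energy_form (v k) g w))
  (EFin \o (fun w => K w * energy_form u g w))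
  (EFin \o (fun w => L * Lg * (2 * (2 * rho) ^+ n) * (sqnorm w * K w)))
  (fun k => measurable_int la (ikf k).1)
  (measurable_int la (integrable_kernel_energy_form K0 mK iK rho0 L0 Lg0 uL gL gs).1)
  (aeW _ (fun w _ => pointwiseE w))
  (integrableZ_real _ measurableT iK)
  (aeW _ (fun w k _ => (ikf k).2 w)).
move: cvI; rewrite [X in _ --> X](EFin_Rintegral _ iu)// => /fine_cvg cvI.
by apply: (cvgr_to_ge cvI); apply: nearW => k; exact: vI.
Unshelve. all: by end_near. Qed.

End weak_limit.

(** * Logarithmic cutoff and energy estimate *)

Section cutoff.
Context {R : realType} {n : nat}.
Local Notation la := (lebesgue_rV R n).
Implicit Types (x y w : 'rV[R]_n).

Definition clamp (t : R) : R := Num.min 1 (Num.max 0 t).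

Lemma clamp_ge0 t : 0 <= clamp t.
Proof. by rewrite /clamp le_min ler01 le_max lexx. Qed.

Lemma clamp_le1 t : clamp t <= 1.
Proof. by rewrite /clamp ge_min lexx. Qed.

Lemma clamp_eq1 t : 1 <= t -> clamp t = 1.
Proof. by move=> t1; rewrite /clamp; apply/min_idPl; rewrite le_max t1 orbT. Qed.

Lemma clamp_eq0 t : t <= 0 -> clamp t = 0.
Proof. by move=> t0; rewrite /clamp (max_idPl t0); apply/min_idPr. Qed.

Lemma clamp_id t : 0 <= t <= 1 -> clamp t = t.
Proof. by move=> /andP[t0 t1]; rewrite /clamp (max_idPr t0); apply/min_idPr. Qed.

Lemma clamp_lipschitz s t : `|clamp s - clamp t| <= `|s - t|.
Proof.
wlog st : s t / s <= t.
  by move=> h; have [/h//|/ltW /h] := leP s t; rewrite distrC (distrC t).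
have clampP u : [\/ u <= 0 /\ clamp u = 0, 1 <= u /\ clamp u = 1 | 0 <= u <= 1 /\ clamp u = u].
  have [u0|u0] := leP u 0; first by apply: Or31; rewrite clamp_eq0.
  have [u1|u1] := leP 1 u; first by apply: Or32; rewrite clamp_eq1.
  by apply: Or33; rewrite clamp_id// !ltW.
rewrite [leRHS]distrC (ger0_norm (_ : 0 <= t - s)) ?subr_ge0// ler_norml.
by case: (clampP s) => -[hs ->]; case: (clampP t) => -[ht ->]; lra.
Qed.

Definition tent (k : nat) x : R := clamp (2 - `|x| / 2 ^+ k).

Lemma tent_lipschitz k x y : `|tent k x - tent k y| <= (2 ^+ k)^-1 * `|x - y|.
Proof.
rewrite (le_trans (clamp_lipschitz _ _))//.
rewrite (_ : _ - _ = (`|y| - `|x|) * (2 ^+ k)^-1); last by ring.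
by rewrite normrM mulrC (ger0_norm (_ : 0 <= _^-1))// ler_wpM2l// distrC ler_dist_dist.
Qed.

Lemma tent_eq1 k x : `|x| <= 2 ^+ k -> tent k x = 1.
Proof.
move=> xk; apply: clamp_eq1; suff : `|x| / 2 ^+ k <= 1 by lra.
by rewrite ler_pdivrMr// mul1r.
Qed.

Lemma tent_eq0 k x : 2 ^+ k.+1 <= `|x| -> tent k x = 0.
Proof.
move=> xk; apply: clamp_eq0; suff : 2 <= `|x| / 2 ^+ k by lra.
by rewrite ler_pdivlMr// -exprS.
Qed.

Lemma tent_diff k x y : `|tent k x - tent k y| <=
  (2 ^+ k)^-1 * `|x - y| * (\1_(box n (2 ^+ k.+1)) x + \1_(box n (2 ^+ k.+1)) y).
Proof.
have c0 : 0 <= (2 ^+ k)^-1 * `|x - y| :> R by rewrite mulr_ge0.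
have [xk|xk] := leP `|x| (2 ^+ k.+1).
  rewrite [X in _ * (X + _)]indicE mem_set//= mulrDr mulr1.
  by rewrite (le_trans (tent_lipschitz _ _ _))// lerDl mulr_ge0// indicE.
have [yk|yk] := leP `|y| (2 ^+ k.+1).
  rewrite [X in _ * (_ + X)]indicE mem_set//= mulrDr mulr1.
  by rewrite (le_trans (tent_lipschitz _ _ _))// lerDr mulr_ge0// indicE.
rewrite (tent_eq0 (ltW xk)) (tent_eq0 (ltW yk)) subrr normr0.
by rewrite mulr_ge0// addr_ge0// indicE.
Qed.

(* Averaging the tents over [N] dyadic scales gives a logarithmic cutoff, whose
   Dirichlet energy is [O(1 / N)] in dimension at most two. *)
Definition cutoff (N : nat) x : R := N%:R^-1 * \sum_(k < N) tent (N + k) x.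

Lemma cutoff_ge0 N x : 0 <= cutoff N x.
Proof. by rewrite mulr_ge0// sumr_ge0// => k _; exact: clamp_ge0. Qed.

Lemma cutoff_le1 N x : cutoff N x <= 1.
Proof.
case: N => [|N]; first by rewrite /cutoff big_ord0 mulr0.
rewrite /cutoff mulrC ler_pdivrMr// mul1r -[X in X%:R]card_ord -sumr_const.
by apply: ler_sum => k _; exact: clamp_le1.
Qed.

Lemma cutoff_eq1 N x : (0 < N)%N -> `|x| <= 2 ^+ N -> cutoff N x = 1.
Proof.
move=> N0 xN; rewrite /cutoff (eq_bigr (fun=> 1)).
  by rewrite sumr_const card_ord mulVf// pnatr_eq0 -lt0n.
move=> k _; apply: tent_eq1; rewrite (le_trans xN)// ler_weXn2l ?leq_addr//; lra.
Qed.

Lemma cutoff_bounded_support N : bounded_support (2 ^+ (N + N)) (cutoff N).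
Proof.
move=> x xN; rewrite /cutoff big1 ?mulr0// => k _; apply: tent_eq0.
rewrite (le_trans _ (ltW xN))// ler_weXn2l ?leq_addr//; first by lra.
by rewrite -addnS leq_add2l.
Qed.

Lemma cutoff_lipschitz N x y : `|cutoff N x - cutoff N y| <= 1 * `|x - y|.
Proof.
case: N => [|N]; first by rewrite /cutoff !big_ord0 !mulr0 subrr normr0 mul1r.
rewrite /cutoff -mulrBr -sumrB normrM ger0_norm// mul1r mulrC ler_pdivrMr//.
rewrite mulr_natr -[X in _ *+ X]card_ord -sumr_const.
apply: (le_trans (ler_norm_sum _ _ _)); apply: ler_sum => k _.
rewrite (le_trans (tent_lipschitz _ _ _))// ler_piMl// invf_le1 ?exprn_gt0//.
by rewrite exprn_ege1//; lra.
Qed.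

(** From the first index with [b k = 1] on, the sum is at most twice its leading term, so its square
    is at most four times the square of that term. Cauchy-Schwarz would lose a factor [l], and with
    it the decay of the cutoff energy. The first conjunct serves the induction. *)
Lemma sum_sqr_geometric (b : nat -> R) (l m : nat) :
  (forall k, b k = 0 \/ b k = 1) ->
  \sum_(k < l) (2 ^+ (m + k))^-1 * b k <= 2 * (2 ^+ m)^-1 /\
  (\sum_(k < l) (2 ^+ (m + k))^-1 * b k) ^+ 2 <=
  4 * \sum_(k < l) ((2 ^+ (m + k))^-1 ^+ 2) * b k.
Proof.
elim: l m b => [|l IH] m b b01.
  by rewrite !big_ord0 expr0n mulr0; split => //; rewrite mulr_ge0.
rewrite !big_ord_recl /= addn0.
have E (F : nat -> R) : \sum_(i < l) F (bump 0 i) = \sum_(i < l) F i.+1.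
  by apply: eq_bigr.
rewrite !(E (fun i => (2 ^+ (m + i))^-1 * b i)) (E (fun i => ((2 ^+ (m + i))^-1 ^+ 2) * b i)).
have [h1 h2] := IH m.+1 (fun k => b k.+1) (fun k => b01 k.+1).
have E1 : \sum_(i < l) (2 ^+ (m + i.+1))^-1 * b i.+1 =
  \sum_(k < l) (2 ^+ (m.+1 + k))^-1 * b k.+1.
  by apply: eq_bigr => i _; rewrite addnS.
have E2 : \sum_(i < l) (2 ^+ (m + i.+1))^-1 ^+ 2 * b i.+1 =
  \sum_(k < l) (2 ^+ (m.+1 + k))^-1 ^+ 2 * b k.+1.
  by apply: eq_bigr => i _; rewrite addnS.
rewrite E1 E2.
set G := \sum_(k < l) _ in h1 h2 *; set G2 := \sum_(k < l) _ in h2 *.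
have G0 : 0 <= G by apply: sumr_ge0 => k _; rewrite mulr_ge0//; case: (b01 k.+1) => ->.
have G20 : 0 <= G2 by apply: sumr_ge0 => k _; rewrite mulr_ge0 ?sqr_ge0//;
  case: (b01 k.+1) => ->.
have a0 : 0 <= (2 ^+ m)^-1 :> R by [].
have h1' : G <= (2 ^+ m)^-1.
  by apply: (le_trans h1); rewrite exprS invfM mulrA divff ?mul1r// lt0r_neq0.
case: (b01 0%N) => ->.
  by rewrite !mulr0 !add0r; split => //; lra.
rewrite !mulr1; move: (2 ^+ m)^-1 a0 h1' => a a0 h1'; split; first by lra.
have : (a + G) ^+ 2 <= (2 * a) ^+ 2 by rewrite ler_pXn2r ?nnegrE//; lra.
by rewrite exprMn; lra.
Qed.

(** At scale [j = N + k] the squared slope [2^(-2j)] meets a volume of order [2^(nj)]; the product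
    is bounded for [n <= 2]. The square of the sum over scales costs no more than the sum of
    squares, so [N] scales with weight [N^(-2)] leave [1 / N]. *)
Lemma cutoff_energy N w : (n <= 2)%N -> (0 < N)%N ->
  \int[la]_x ((cutoff N (x + w) - cutoff N x) ^+ 2) <= 256 / N%:R * sqnorm w.
Proof.
move=> n2 N0.
pose a (k : nat) : R := (2 ^+ (N + k))^-1.
pose S (k : nat) : set 'rV[R]_n := box n (2 ^+ (N + k).+1).
(* Here [8 = 2 * 4], with [2] from squaring the sum of the values at [x] and [x + w] and [4] from
   [sum_sqr_geometric]. Two boxes of volume at most [(4 * 2 ^ (N + k)) ^ 2] then give
   [8 * 2 * 16 = 256]. *)
pose c (k : nat) : R := 8 * `|w| ^+ 2 * N%:R^-1 ^+ 2 * a k ^+ 2.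
have N00 : N%:R != 0 :> R by rewrite pnatr_eq0 -lt0n.
have a0 k : 0 <= a k by rewrite /a.
have pt x : (cutoff N (x + w) - cutoff N x) ^+ 2 <=
  \sum_(k < N) c k * (\1_(S k) x + \1_(S k) (x + w)).
  pose G y : R := \sum_(k < N) a k * \1_(S k) y.
  have G0 y : 0 <= G y by apply: sumr_ge0 => k _; rewrite mulr_ge0 ?indicE.
  have hG y : G y ^+ 2 <= 4 * \sum_(k < N) a k ^+ 2 * \1_(S k) y.
    apply: (sum_sqr_geometric (b := fun k => \1_(S k) y) N N _).2 => k.
    by rewrite indicE; case: (_ \in _); [right|left].
  have h : `|cutoff N (x + w) - cutoff N x| <= N%:R^-1 * `|w| * (G (x + w) + G x).
    rewrite /cutoff -mulrBr -sumrB normrM ger0_norm// -mulrA ler_wpM2l//.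
    apply: (le_trans (ler_norm_sum _ _ _)); rewrite /G -big_split mulr_sumr.
    apply: ler_sum => k _; apply: (le_trans (tent_diff _ _ _)).
    by rewrite (addrC x) addrK /= -mulrDr mulrA [`|w| * _]mulrC.
  apply: (@le_trans _ _ ((N%:R^-1 * `|w| * (G (x + w) + G x)) ^+ 2)).
    by rewrite -[leLHS]real_normK ?num_real// ler_pXn2r ?nnegrE// (le_trans _ h).
  rewrite exprMn.
  have h2 : (G (x + w) + G x) ^+ 2 <= 2 * (G (x + w) ^+ 2 + G x ^+ 2).
    by have := sqr_ge0 (G (x + w) - G x); lra.
  apply: (@le_trans _ _ ((N%:R^-1 * `|w|) ^+ 2
    * (2 * (4 * \sum_(k < N) a k ^+ 2 * \1_(S k) (x + w) +
    4 * \sum_(k < N) a k ^+ 2 * \1_(S k) x)))).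
    rewrite ler_wpM2l ?sqr_ge0// (le_trans h2)// ler_wpM2l// lerD//.
  rewrite -mulrDr -big_split /= !mulr_sumr; apply: ler_sum => k _.
  by rewrite /c le_eqVlt; apply/orP; left; apply/eqP; ring.
have cS : continuous (fun x => (cutoff N (x + w) - cutoff N x)
  * (cutoff N (x + w) - cutoff N x)).
  have cc := continuous_of_lipschitz (cutoff_lipschitz N).
  by apply: continuous_mulr; apply: continuous_subr => //; exact: continuous_comp_shift.
have c0 k : 0 <= c k by rewrite /c !mulr_ge0// sqr_ge0.
rewrite -lee_fin -EFin_Rintegral//; last first.
  apply: (integrable_continuous (rho := 2 ^+ (N + N) + `|w|)) => //.
  apply: bounded_supportMr; apply: bounded_supportB.
    by apply: bounded_support_shift; exact: cutoff_bounded_support.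
  by refine (bounded_supportW _ (@cutoff_bounded_support N)); rewrite lerDl.
have mS k : measurable (S k) by exact: measurable_box.
have m1 k : measurable_fun setT (fun x : 'rV[R]_n => (\1_(S k) x)%:E : \bar R).
  by apply/measurable_EFinP; exact: measurable_indic.
have m2 k : measurable_fun setT (fun x : 'rV[R]_n => (\1_(S k) (x + w))%:E : \bar R).
  apply/measurable_EFinP; apply: (measurableT_comp _ (measurable_rV_shift w)).
  exact: measurable_indic.
apply: (@le_trans _ _ (\int[la]_x
  (\sum_(k < N) (c k)%:E * ((\1_(S k) x)%:E + (\1_(S k) (x + w))%:E)))%E).
  apply: ge0_le_integral => //.
  - by move=> x _; rewrite lee_fin sqr_ge0.
  - by apply/measurable_EFinP; exact: continuous_measurable_rV.
  - by apply: emeasurable_sum => k; apply: emeasurable_funM => //; exact: emeasurable_funD.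
  - move=> x _; apply: le_trans
    (_ : (_ <= (\sum_(k < N) c k * (\1_(S k) x + \1_(S k) (x + w)))%:E)%E) _.
      by rewrite lee_fin; exact: pt.
    by rewrite -sumEFin; apply: lee_sum => k _; rewrite EFinM EFinD.
rewrite ge0_integral_sum//; last 2 first.
- by move=> k; apply: emeasurable_funM => //; exact: emeasurable_funD.
- by move=> k x _; rewrite mule_ge0 ?adde_ge0 ?lee_fin ?indicE.
have E k : (\int[la]_x ((c k)%:E * ((\1_(S k) x)%:E + (\1_(S k) (x + w))%:E)) =
   (c k * (2 * (2 * 2 ^+ (N + k).+1) ^+ n))%:E)%E.
  rewrite ge0_integralZl//; first last.
  - by rewrite lee_fin.
  - by move=> x _; rewrite adde_ge0 ?lee_fin ?indicE.
  - exact: emeasurable_funD.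
  rewrite ge0_integralD//; try by move=> x _; rewrite lee_fin indicE.
  rewrite (@integral_rV_shift _ _ w (EFin \o \1_(S k))); last exact: m1.
  rewrite integral_indic ?setIT//= lebesgue_rV_box// -EFinD -EFinM.
  by congr EFin; ring.
under eq_bigr do rewrite E.
rewrite sumEFin lee_fin.
apply: (@le_trans _ _ (\sum_(k < N) 256 * N%:R^-1 ^+ 2 * sqnorm w)); last first.
  rewrite sumr_const card_ord -mulr_natr le_eqVlt; apply/orP; left; apply/eqP.
  by field.
apply: ler_sum => k _.
have h3 : (2 * 2 ^+ (N + k).+1) ^+ n <= (2 * 2 ^+ (N + k).+1) ^+ 2 :> R.
  by rewrite ler_weXn2l// -exprS exprn_ege1//; lra.
apply: (@le_trans _ _ (c k * (2 * (2 * 2 ^+ (N + k).+1) ^+ 2))).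
  by rewrite ler_wpM2l// ler_wpM2l.
have -> : c k * (2 * (2 * 2 ^+ (N + k).+1) ^+ 2) = 256 * N%:R^-1 ^+ 2 * `|w| ^+ 2.
  have p0 : 2 ^+ (N + k) != 0 :> R by rewrite lt0r_neq0.
  by rewrite /c /a (exprS 2 (N + k)); move: (2 ^+ (N + k)) p0 => p p0; field; rewrite p0 N00.
apply: ler_wpM2l; last exact: norm_le_sqnorm.
by rewrite mulr_ge0// sqr_ge0.
Qed.

End cutoff.

Section energy.
Context {R : realType} {n : nat}.
Local Notation la := (lebesgue_rV R n).
Implicit Types (rho A L Lg e r om M : R) (x y w : 'rV[R]_n) (f g v u : 'rV[R]_n -> R).
Variable K : 'rV[R]_n -> R.
Hypothesis K0 : forall w, 0 <= K w.
Hypothesis mK : measurable_fun setT K.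
Hypothesis eK : even_fun K.
Hypothesis iK : la.-integrable setT (EFin \o (fun w => sqnorm w * K w)).

Definition energy u N w := \int[la]_x ((u (x + w) - u x) ^+ 2 * cutoff N x ^+ 2).

(** Read [a], [b] as the values of [u] and [p], [q] as those of the cutoff at [x] and [x + w]. The
    shifts by [M] cancel, leaving [(b - a) * (q^2 b - p^2 a)]; its symmetric part is the energy, and
    half of that absorbs the cross term. *)
Let caccioppoli (a b p q M : R) : `|a| <= M -> `|b| <= M ->
  (b - a) ^+ 2 * p ^+ 2 / 4 - 2 * M ^+ 2 * (q - p) ^+ 2 <=
  (b - a) * (q ^+ 2 * (b + M) - p ^+ 2 * (a + M)) - (b - a) * (M * q ^+ 2 - M * p ^+ 2).
Proof.
move=> aM bM; pose X := (b - a) * (p + q); pose Y := (a + b) * (q - p).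
have M0 : 0 <= M := le_trans (normr_ge0 a) aM.
(* [X * Y >= - X ^+ 2 / 4 - Y ^+ 2] *)
have hXY : 0 <= (X / 2 + Y) ^+ 2 by exact: sqr_ge0.
have hX : X ^+ 2 <= 2 * (b - a) ^+ 2 * (p ^+ 2 + q ^+ 2).
  have := mulr_ge0 (sqr_ge0 (b - a)) (sqr_ge0 (p - q)); rewrite /X; lra.
have hY : Y ^+ 2 <= 4 * M ^+ 2 * (q - p) ^+ 2.
  rewrite /Y exprMn ler_wpM2r ?sqr_ge0// (_ : 4 * _ = (2 * M) ^+ 2); last by ring.
  rewrite -[leLHS]real_normK ?num_real// ler_pXn2r ?nnegrE ?mulr_ge0//.
  by rewrite (le_trans (ler_normD _ _))//; lra.
have hq : 0 <= (b - a) ^+ 2 * q ^+ 2 by rewrite mulr_ge0 ?sqr_ge0.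
have -> : (b - a) * (q ^+ 2 * (b + M) - p ^+ 2 * (a + M)) - (b - a)
  * (M * q ^+ 2 - M * p ^+ 2) =
   (b - a) ^+ 2 * (p ^+ 2 + q ^+ 2) / 2 + X * Y / 2.
  by rewrite /X /Y; field.
lra.
Qed.

Let absorb (a b c d : R) : 4^-1 * a - b <= c -> c <= 2 * d -> a <= 8 * d + 4 * b.
Proof. by move=> *; lra. Qed.

(** A Caccioppoli inequality: integrating the pointwise bound over [x] and [w] leaves the cutoff
    energy as the only error, which [cutoff_energy] makes [O(1 / N)]. *)
Lemma energy_estimate u f L M N : (n <= 2)%N -> (0 < N)%N -> 0 <= L ->
  (forall x y, `|u x - u y| <= L * `|x - y|) -> (forall x, `|u x| <= M) ->
  principal_value K u f -> continuous f ->
  la.-integrable setT (EFin \o (fun w => K w * energy u N w)) /\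
  \int[la]_w (K w * energy u N w) <=
  8 * (\int[la]_x (cutoff N x ^+ 2 * (u x * f x))) +
  8 * M ^+ 2 * (256 / N%:R) * \int[la]_w (sqnorm w * K w).
Proof.
move=> n2 N0 L0 uL uM upv cf.
have M0 : 0 <= M := le_trans (normr_ge0 _) (uM 0).
set eta := @cutoff R n N; pose rho : R := 2 ^+ (N + N).
have rho0 : 0 <= rho by rewrite exprn_ge0.
have eta0 x : 0 <= eta x := cutoff_ge0 N x.
have eta1 x : eta x <= 1 := cutoff_le1 N x.
have etaL : forall x y, `|eta x - eta y| <= 1 * `|x - y| := cutoff_lipschitz N.
have etas : bounded_support rho eta := @cutoff_bounded_support R n N.
have cu := continuous_of_lipschitz uL; have ce := continuous_of_lipschitz etaL.
have ce2 : continuous (fun x => eta x ^+ 2) by exact: continuous_mulr.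
have eta2L x y : `|eta x ^+ 2 - eta y ^+ 2| <= 2 * `|x - y|.
  rewrite subr_sqr normrM mulrC ler_pM//; last by have := etaL x y; rewrite mul1r.
  by rewrite ger0_norm ?addr_ge0//; have := eta1 x; have := eta1 y; lra.
(* The signed test function [eta^2 u] is [g1 - g2] with both pieces nonnegative. The upper bound for
   [g1] comes from the equation of [- u], the lower bound for [g2] from that of [u]. *)
pose g1 x := eta x ^+ 2 * (u x + M); pose g2 x := M * eta x ^+ 2.
have uM0 x : 0 <= u x + M by have := uM x; rewrite ler_norml => /andP[]; lra.
have g10 x : 0 <= g1 x by rewrite mulr_ge0// sqr_ge0.
have g20 x : 0 <= g2 x by rewrite mulr_ge0// sqr_ge0.
have g2L x y : `|g2 x - g2 y| <= (2 * M) * `|x - y|.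
  by rewrite /g2 -mulrBr normrM (ger0_norm M0) (mulrC 2) -mulrA ler_wpM2l.
have g1L x y : `|g1 x - g1 y| <= (4 * M + L) * `|x - y|.
  rewrite (_ : _ - _ = (eta x ^+ 2 - eta y ^+ 2) * (u x + M) + eta y ^+ 2 * (u x - u y));
    last by rewrite /g1; ring.
  rewrite (le_trans (ler_normD _ _))// [leRHS]mulrDl lerD// normrM.
    rewrite (_ : 4 * M * _ = (2 * `|x - y|) * (2 * M)); last by ring.
    rewrite ler_pM// ger0_norm//; have := uM x; rewrite ler_norml => /andP[]; lra.
  rewrite -[leRHS]mul1r ler_pM// ger0_norm ?sqr_ge0// expr2.
  by rewrite mulr_ile1.
have e2s : bounded_support rho (fun x => eta x ^+ 2).
  by move=> x hx; rewrite etas// expr0n.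
have g1s : bounded_support rho g1 by exact: bounded_supportMl.
have g2s : bounded_support rho g2 by exact: bounded_supportMr.
have cg1 := continuous_of_lipschitz g1L; have cg2 := continuous_of_lipschitz g2L.
have Lg1 : 0 <= 4 * M + L by lra.
have Lg2 : 0 <= 2 * M by lra.
have w2 := weak_inequality K0 mK eK iK L0 Lg2 rho0 uL upv cf g20 g2L g2s.
have uLN : forall x y, `|- u x - - u y| <= L * `|x - y|.
  by move=> x y; rewrite -opprD normrN.
have cfN : continuous (fun x => - f x).
  by move=> x; apply: (@continuousN _ _ _ f); exact: cf.
have w1 := weak_inequality K0 mK eK iK L0 Lg1 rho0 uLN
  (principal_value_opp K0 mK iK L0 uL upv) cfN g10 g1L g1s.
have [i1 b1] := integrable_kernel_energy_form K0 mK iK rho0 L0 Lg1 uL g1L g1s.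
have [i2 b2] := integrable_kernel_energy_form K0 mK iK rho0 L0 Lg2 uL g2L g2s.
have ig1f : la.-integrable setT (EFin \o (fun x => g1 x * f x)).
  by apply: (integrable_continuous (rho := rho));
    [exact: continuous_mulr|exact: bounded_supportMl].
have ig2f : la.-integrable setT (EFin \o (fun x => g2 x * f x)).
  by apply: (integrable_continuous (rho := rho));
    [exact: continuous_mulr|exact: bounded_supportMl].
have {}w1 : \int[la]_w (K w * energy_form u g1 w) <= 2 * \int[la]_x (g1 x * f x).
  move: w1.
  have -> : \int[la]_x (g1 x * - f x) = - \int[la]_x (g1 x * f x).
    by rewrite -mulN1r -RintegralZl//; apply: eq_Rintegral => x _; ring.
  have -> : \int[la]_w (K w * energy_form (fun x => - u x) g1 w) =
    - \int[la]_w (K w * energy_form u g1 w).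
    rewrite -mulN1r -RintegralZl//; apply: eq_Rintegral => w _.
    rewrite mulrCA; congr (_ * _); rewrite -RintegralZl//;
      last exact: integrable_energy_form g1s.
    by apply: eq_Rintegral => x _; ring.
  by rewrite mulrN lerN2.
have wsum : \int[la]_w (K w * energy_form u g1 w) - \int[la]_w (K w * energy_form u g2 w) <=
    2 * \int[la]_x (eta x ^+ 2 * (u x * f x)).
  have -> : \int[la]_x (eta x ^+ 2 * (u x * f x)) =
    \int[la]_x (g1 x * f x) - \int[la]_x (g2 x * f x).
    by rewrite -RintegralB//; apply: eq_Rintegral => x _; rewrite /g1 /g2; ring.
  by rewrite mulrBr; exact: lerB.
have iE w : la.-integrable setT (EFin \o (fun x => (u (x + w) - u x) ^+ 2 * eta x ^+ 2)).
  apply: (integrable_continuous (rho := rho)); last exact: bounded_supportMr.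
  apply: continuous_mulr => //.
  by apply: continuous_mulr; apply: continuous_subr => //; exact: continuous_comp_shift.
have mE : measurable_fun setT (energy u N).
  apply: (measurable_Rintegral_param (F :=
    fun p => (u (p.1 + p.2) - u p.1) ^+ 2 * eta p.1 ^+ 2)).
  apply: measurable_funM; apply: measurable_funX.
    by apply: measurable_diff; exact: continuous_measurable_rV.
  by apply: measurable_comp_fst; exact: continuous_measurable_rV.
have ie2 : la.-integrable setT (EFin \o (fun x => eta x ^+ 2))
  by exact: integrable_continuous e2s.
have E0 w : 0 <= energy u N w by apply: Rintegral_ge0 => x _; rewrite mulr_ge0 ?sqr_ge0.
have Eb w : energy u N w <= L ^+ 2 * (\int[la]_x (eta x ^+ 2)) * sqnorm w.
  apply: (@le_trans _ _ (\int[la]_x (L ^+ 2 * sqnorm w * eta x ^+ 2))).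
    apply: le_Rintegral => //; first exact: integrableZ_real.
    move=> x _; rewrite ler_wpM2r ?sqr_ge0//.
    apply: (@le_trans _ _ ((L * `|w|) ^+ 2)).
      rewrite -[leLHS]real_normK ?num_real// ler_pXn2r ?nnegrE ?mulr_ge0//.
      by rewrite (le_trans (uL _ _))// addrAC subrr add0r.
    by rewrite exprMn ler_wpM2l ?sqr_ge0// norm_le_sqnorm.
  by rewrite RintegralZl// mulrAC.
have iKE : la.-integrable setT (EFin \o (fun w => K w * energy u N w)).
  apply: (le_integrable_real (g :=
    fun w => L ^+ 2 * (\int[la]_x (eta x ^+ 2)) * (sqnorm w * K w))) => //.
  - exact: measurable_funM.
  - by move=> w _; rewrite ger0_norm ?mulr_ge0// mulrC mulrA ler_wpM2r.
  - exact: integrableZ_real.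
split => //.
have pt w : K w * energy u N w / 4 - 2 * M ^+ 2 * (256 / N%:R) * (sqnorm w * K w) <=
    K w * energy_form u g1 w - K w * energy_form u g2 w.
  have -> : K w * energy u N w / 4 - 2 * M ^+ 2 * (256 / N%:R) * (sqnorm w * K w) =
     K w * (energy u N w / 4 - 2 * M ^+ 2 * (256 / N%:R * sqnorm w)) by ring.
  rewrite -mulrBr ler_wpM2l//.
  have iD : la.-integrable setT (EFin \o (fun x => (eta (x + w) - eta x) ^+ 2)).
    exact: (integrable_energy_form w ce ce etas).
  apply: (@le_trans _ _ (energy u N w / 4 - 2 * M ^+ 2 * \int[la]_x
    ((eta (x + w) - eta x) ^+ 2))).
    by rewrite lerD2l lerN2 ler_wpM2l ?mulr_ge0 ?sqr_ge0//; exact: cutoff_energy.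
  rewrite /energy_form -RintegralB//;
    [|exact: integrable_energy_form g1s|exact: integrable_energy_form g2s].
  rewrite /energy mulrC -RintegralZl// -RintegralZl// -RintegralB//;
    [|exact: integrableZ_real|exact: integrableZ_real].
  apply: le_Rintegral => //.
  - by apply: integrableB_real => //; exact: integrableZ_real.
  - by apply: integrableB_real => //;
    [exact: integrable_energy_form g1s|exact: integrable_energy_form g2s].
  move=> x _; have := caccioppoli (eta x) (eta (x + w)) (uM x) (uM (x + w)).
  by rewrite mulrC.
have h : \int[la]_w (4^-1 * (K w * energy u N w) - 2 * M ^+ 2 * (256 / N%:R)
  * (sqnorm w * K w)) <=
    \int[la]_w (K w * energy_form u g1 w - K w * energy_form u g2 w).
  apply: le_Rintegral => //.
  - by apply: integrableB_real => //; exact: integrableZ_real.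
  - exact: integrableB_real.
  - by move=> w _; have := pt w; rewrite [_ / 4]mulrC.
move: h; rewrite RintegralB//; [|exact: integrableZ_real|exact: integrableZ_real].
rewrite RintegralZl// RintegralZl// RintegralB//.
move=> h; apply: (le_trans (absorb h wsum)).
by rewrite le_eqVlt; apply/orP; left; apply/eqP; ring.
Qed.

End energy.

(** * Constancy from vanishing energies, and the Liouville property of systems *)

Section constancy.
Context {R : realType} {n : nat}.
Local Notation la := (lebesgue_rV R n).
Implicit Types (r L C : R) (x y w : 'rV[R]_n) (f u : 'rV[R]_n -> R).

Lemma measurable_cball x r : measurable [set y | `|y - x| <= r].
Proof.
rewrite (_ : [set y | _] = (fun y => 1 *: y + (- x)) @^-1` box n r); last first.
  by apply/seteqP; split => y; rewrite /box /= scale1r.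
rewrite -[X in measurable X]setTI; apply: measurable_rV_affine => //.
exact: measurable_box.
Qed.

Lemma lebesgue_rV_cball x r : 0 <= r ->
  la [set y | `|y - x| <= r] = ((2 * r) ^+ n)%:E.
Proof.
move=> r0; rewrite -(lebesgue_rV_box n r0).
rewrite -(@lebesgue_rV_affine _ _ 1 (- x) (box n r)); first last.
- exact: measurable_box.
- by left.
by congr (la _); apply/seteqP; split => y; rewrite /box /= scale1r.
Qed.

(** The origin is joined to [x] by [k.+1] equal steps shorter than [r]. *)
Lemma locally_constant_constant u r : 0 < r ->
  (forall x w, `|w| < r -> u (x + w) = u x) -> exists a, forall x, u x = a.
Proof.
move=> r0 loc; exists (u 0) => x.
have [k kx] : exists k : nat, `|x| / r < k.+1%:R.
  by exists (Num.truncn (`|x| / r)); exact: truncnS_gt.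
pose w := k.+1%:R^-1 *: x.
have wr : `|w| < r.
  by rewrite normrZ ger0_norm// mulrC ltr_pdivrMr// mulrC -ltr_pdivrMr.
have H (l : nat) : u (l%:R *: w) = u 0.
  elim: l => [|l IH]; first by rewrite scale0r.
  by rewrite -natr1 scalerDl scale1r loc.
by rewrite -(H k.+1) /w scalerA mulfV ?scale1r// pnatr_eq0.
Qed.

(** If [u] differs at [x0] and [x0 + w0], Lipschitz continuity keeps a fixed oscillation for all
    base points near [x0] and increments near [w0]. There the kernel is at least [k0] off [Z] and
    the cutoff is [1] for large [N], so the energies have a positive lower bound, against
    [C / N]. *)
Lemma constant_of_vanishing_energy (K : 'rV[R]_n -> R) (Z : set 'rV[R]_n) u (k0 d0 : R) L C :
  (forall w, 0 <= K w) -> measurable Z -> la Z = 0%E -> 0 < k0 -> 0 < d0 ->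
  (forall w, ~ Z w -> w != 0 -> `|w| <= d0 -> k0 <= K w) ->
  0 <= L -> (forall x y, `|u x - u y| <= L * `|x - y|) ->
  (forall N, (0 < N)%N -> la.-integrable setT (EFin \o (fun w => K w * energy u N w)) /\
     \int[la]_w (K w * energy u N w) <= C / N%:R) ->
  exists a, forall x, u x = a.
Proof.
move=> K0 mZ Z0 k00 d00 Klow L0 uL HE.
apply: (locally_constant_constant d00) => x0 w0 w0d.
apply/eqP; apply: contraT => neq.
have w00 : w0 != 0 by apply: contraNneq neq => ->; rewrite addr0.
pose d := `|u (x0 + w0) - u x0|.
have dp : 0 < d by rewrite normr_gt0 subr_eq0.
(* The three bounds ensure, in turn, that the oscillation stays above [d / 2], that [|w| <= d0], and
   that [w] avoids the origin. *)
pose r := Num.min (d / (6 * (L + 1))) (Num.min (d0 - `|w0|) (`|w0| / 2)).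
have r0 : 0 < r.
  rewrite !lt_min; apply/andP; split; first by rewrite divr_gt0//; lra.
  by rewrite subr_gt0 w0d /= divr_gt0// normr_gt0.
have r1 : 3 * L * r <= d / 2.
  have h : r <= d / (6 * (L + 1)) by rewrite ge_min lexx.
  have L1 : 0 < 6 * (L + 1) by lra.
  have : r * (6 * (L + 1)) <= d by rewrite -ler_pdivlMr.
  have : 0 <= r * L by rewrite mulr_ge0// ltW.
  lra.
have r2 : r <= d0 - `|w0| by rewrite !ge_min lexx orbT.
have r3 : r <= `|w0| / 2 by rewrite !ge_min lexx !orbT.
have osc x w : `|x - x0| <= r -> `|w - w0| <= r -> (d / 2) ^+ 2 <= (u (x + w) - u x) ^+ 2.
  move=> hx hw.
  rewrite -[leRHS]real_normK ?num_real// ler_pXn2r ?nnegrE ?divr_ge0 ?(ltW dp)//.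
  have h1 : `|u x - u x0| <= L * r by rewrite (le_trans (uL _ _))// ler_wpM2l.
  have h2 : `|u (x + w) - u (x0 + w0)| <= L * (r + r).
    rewrite (le_trans (uL _ _))// ler_wpM2l// opprD addrACA (le_trans (ler_normD _ _))//.
    exact: lerD.
  have : d <= `|u (x + w) - u x| + `|u x - u x0| + `|u (x + w) - u (x0 + w0)|.
    rewrite /d (_ : u (x0 + w0) - u x0 =
      (u (x + w) - u x) + (u x - u x0) - (u (x + w) - u (x0 + w0))); last by ring.
    by rewrite (le_trans (ler_normB _ _))// lerD2r ler_normD.
  lra.
pose B x := [set y | `|y - x| <= r].
have mB x : measurable (B x) by exact: measurable_cball.
have r00 := ltW r0.
have lB x : la (B x) = ((2 * r) ^+ n)%:E := lebesgue_rV_cball x r00.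
pose c := k0 * ((d / 2) ^+ 2 * (2 * r) ^+ n).
have c0 : 0 <= c by rewrite /c !mulr_ge0 ?sqr_ge0 ?exprn_ge0 ?mulr_ge0// ltW.
have cp : 0 < c * (2 * r) ^+ n by rewrite !mulr_gt0// ?exprn_gt0 ?mulr_gt0// divr_gt0.
have [N N1 hN] : exists2 N, (0 < N)%N & `|x0| + r <= 2 ^+ N /\ C / N%:R < c * (2 * r) ^+ n.
  (* As [2 ^ N > N], the first entry of the maximum makes the cutoff [1] near [x0]; the second
     pushes [C / N] below the energy bound. *)
  pose a := Num.truncn (`|x0| + r); pose b := Num.truncn (C / (c * (2 * r) ^+ n)).
  exists (maxn a.+1 b.+1); first by rewrite leq_max.
  split.
    apply: (@le_trans _ _ a.+1%:R); first by rewrite ltW// truncnS_gt.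
    rewrite -natrX ler_nat; apply: leq_trans (leq_maxl _ b.+1) _.
    by apply: ltnW; exact: ltn_expl.
  rewrite ltr_pdivrMr ?ltr0n ?leq_max// mulrC -ltr_pdivrMr//.
  by rewrite (lt_le_trans (truncnS_gt _))// ler_nat leq_maxr.
have [iE leE] := HE _ N1.
suff : c * (2 * r) ^+ n <= \int[la]_w (K w * energy u N w).
  by move=> /le_trans/(_ leE); rewrite leNgt hN.2.
have low w : B w0 w -> (d / 2) ^+ 2 * (2 * r) ^+ n <= energy u N w.
  move=> Bw; rewrite -lee_fin /energy.
  have cu := continuous_of_lipschitz uL.
  have ce := continuous_of_lipschitz (@cutoff_lipschitz R n N).
  rewrite -EFin_Rintegral//; last first.
    apply: (integrable_continuous (rho := 2 ^+ (N + N))).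
      by apply: continuous_mulr;
        [apply: continuous_mulr; apply: continuous_subr => //;
        exact: continuous_comp_shift|exact: continuous_mulr].
    by apply: bounded_supportMr => x hx; rewrite (@cutoff_bounded_support _ _ N)// expr0n.
  have -> : ((d / 2) ^+ 2 * (2 * r) ^+ n)%:E =
    (\int[la]_x (((d / 2) ^+ 2)%:E * (\1_(B x0) x)%:E))%E.
    rewrite ge0_integralZl//; first last.
    - by rewrite lee_fin sqr_ge0.
    - by apply/measurable_EFinP; exact: measurable_indic.
    by rewrite integral_indic ?setIT// EFinM; congr (_ * _)%E; exact/esym/lB.
  apply: ge0_le_integral => //.
  - by move=> x _; rewrite mule_ge0 ?lee_fin ?sqr_ge0// indicE.
  - by apply: emeasurable_funM => //; apply/measurable_EFinP; exact: measurable_indic.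
  - apply/measurable_EFinP; apply: continuous_measurable_rV.
    by apply: continuous_mulr;
      [apply: continuous_mulr; apply: continuous_subr => //;
      exact: continuous_comp_shift|exact: continuous_mulr].
  move=> x _; rewrite -EFinM lee_fin indicE; case: (boolP (x \in B x0)) => xB; last first.
    by rewrite mulr0 mulr_ge0 ?sqr_ge0.
  move/set_mem : xB => xB; rewrite cutoff_eq1 ?expr1n ?mulr1//; first exact: osc.
  apply: le_trans hN.1; rewrite -[x](subrK x0) (le_trans (ler_normD _ _))// addrC lerD2l.
  exact: xB.
have mBZ : measurable (B w0 `\` Z) by exact: measurableD.
have lBZ : la (B w0 `\` Z) = ((2 * r) ^+ n)%:E.
  rewrite -(lB w0); apply/eqP; rewrite eq_le; apply/andP; split.
    by apply: le_measure; rewrite ?inE//; exact: subDsetl.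
  apply: (@le_trans _ _ (la (B w0 `\` Z `|` Z))).
    apply: le_measure; rewrite ?inE//; first exact: measurableU.
    by move=> y By; have [Zy|Zy] := pselect (Z y); [right|left].
  by apply: le_trans (measureU2 _ _ _) _ => //; rewrite [X in (_ + X <= _)%E]Z0 adde0.
rewrite -lee_fin -EFin_Rintegral//.
have -> : (c * (2 * r) ^+ n)%:E = (\int[la]_w (c%:E * (\1_(B w0 `\` Z) w)%:E))%E.
  rewrite ge0_integralZl//; first last.
  - by apply/measurable_EFinP; exact: measurable_indic.
  by rewrite integral_indic ?setIT// EFinM; congr (_ * _)%E; exact/esym/lBZ.
apply: ge0_le_integral => //.
- by move=> x _; rewrite mule_ge0 ?lee_fin// indicE.
- by apply: emeasurable_funM => //; apply/measurable_EFinP; exact: measurable_indic.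
- exact: measurable_int iE.
move=> w _; rewrite -EFinM lee_fin indicE; case: (boolP (w \in _)) => wB; last first.
  rewrite mulr0 mulr_ge0//; apply: Rintegral_ge0 => x _.
  by rewrite mulr_ge0 ?sqr_ge0.
move/set_mem : wB => -[wB Zw];
  rewrite mulr1 /c ler_pM ?mulr_ge0 ?sqr_ge0 ?exprn_ge0 ?mulr_ge0 ?low ?(ltW k00) ?(ltW dp)//.
have hw : `|w - w0| <= r by exact: wB.
apply: Klow => //.
- apply: contraTneq hw => ->; rewrite sub0r normrN -ltNge; apply: (le_lt_trans r3).
  by rewrite ltr_pdivrMr// ltr_pMr ?normr_gt0//; lra.
- rewrite -[w](subrK w0) (le_trans (ler_normD _ _))//; lra.
Qed.

End constancy.

Section liouville.
Context {R : realType} {m n : nat}.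
Local Notation la := (lebesgue_rV R n).

Lemma Rintegral_sum d (T : measurableType d) (mu : {measure set T -> \bar R})
    (I : Type) (s : seq I) (F : I -> T -> R) :
  (forall i, mu.-integrable setT (EFin \o F i)) ->
  mu.-integrable setT (EFin \o (fun x => \sum_(i <- s) F i x)) /\
  \int[mu]_x (\sum_(i <- s) F i x) = \sum_(i <- s) \int[mu]_x F i x.
Proof.
move=> iF; elim: s => [|i s [IH1 IH2]].
  have -> : (fun x => \sum_(i <- [::]) F i x) = fun=> 0 by apply/funext => x; rewrite big_nil.
  by rewrite big_nil; split; [exact: integrable0|rewrite /Rintegral integral0_eq].
have -> : (fun x => \sum_(j <- i :: s) F j x) = fun x => F i x + \sum_(j <- s) F j x.
  by apply/funext => x; rewrite big_cons.
by rewrite big_cons -IH2 RintegralD//; split => //; exact: integrableD_real.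
Qed.

(** The sign condition concerns the sum over components only, so the energy estimates are added;
    each energy, being nonnegative, is then bounded by the total. *)
Lemma liouville_system (n_le2 : (n <= 2)%N) (K u f : 'I_m -> 'rV[R]_n -> R)
    (L M k0 d0 : 'I_m -> R) (Z : 'I_m -> set 'rV[R]_n) :
  (forall i w, 0 <= K i w) -> (forall i, measurable_fun setT (K i)) ->
  (forall i, even_fun (K i)) ->
  (forall i, la.-integrable setT (EFin \o (fun w => sqnorm w * K i w))) ->
  (forall i, measurable (Z i)) -> (forall i, la (Z i) = 0%E) ->
  (forall i, 0 < k0 i) -> (forall i, 0 < d0 i) ->
  (forall i w, ~ Z i w -> w != 0 -> `|w| <= d0 i -> k0 i <= K i w) ->
  (forall i, 0 <= L i) -> (forall i x y, `|u i x - u i y| <= L i * `|x - y|) ->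
  (forall i x, `|u i x| <= M i) -> (forall i, principal_value (K i) (u i) (f i)) ->
  (forall i, continuous (f i)) -> (forall x, \sum_i u i x * f i x <= 0) ->
  forall i, exists a, forall x, u i x = a.
Proof.
move=> K0 mK eK iK mZ Z0 k00 d00 Klow L0 uL uM upv cf sum0 i.
pose C := \sum_j 8 * M j ^+ 2 * 256 * \int[la]_w (sqnorm w * K j w).
apply: (@constant_of_vanishing_energy _ _ (K i) (Z i) (u i) _ _ _ C (K0 i) (mZ i) (Z0 i)
  (k00 i) (d00 i) (Klow i) (L0 i) (uL i)) => N N0.
have H j := energy_estimate (K0 j) (mK j) (eK j) (iK j) n_le2 N0 (L0 j) (uL j) (uM j)
  (upv j) (cf j).
split; first exact: (H i).1.
apply: (@le_trans _ _ (\sum_j \int[la]_w (K j w * energy (u j) N w))).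
  rewrite (bigD1 i)//= lerDl; apply: sumr_ge0 => j _; apply: Rintegral_ge0 => w _.
  by rewrite mulr_ge0//; apply: Rintegral_ge0 => x _; rewrite mulr_ge0 ?sqr_ge0.
apply: (le_trans (ler_sum _ (fun j _ => (H j).2))).
rewrite big_split /= -mulr_sumr.
have cu j := continuous_of_lipschitz (uL j).
have ce := continuous_of_lipschitz (@cutoff_lipschitz R n N).
have e2s : bounded_support (2 ^+ (N + N)) (fun x => @cutoff R n N x ^+ 2).
  by move=> x hx; rewrite (@cutoff_bounded_support _ _ N)// expr0n.
have ii j : la.-integrable setT (EFin \o (fun x => cutoff N x ^+ 2 * (u j x * f j x))).
  apply: (integrable_continuous (rho := 2 ^+ (N + N))); last exact: bounded_supportMl.
  by apply: continuous_mulr; apply: continuous_mulr.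
have le0 : \sum_j \int[la]_x (cutoff N x ^+ 2 * (u j x * f j x)) <= 0.
  have -> : \sum_j \int[la]_x (cutoff N x ^+ 2 * (u j x * f j x)) =
      \int[la]_x (\sum_j cutoff N x ^+ 2 * (u j x * f j x)).
    by rewrite (Rintegral_sum _ ii).2.
  rewrite -oppr_ge0 -mulN1r -RintegralZl//; last exact: (Rintegral_sum _ ii).1.
  apply: Rintegral_ge0 => x _; rewrite mulN1r oppr_ge0 -mulr_sumr.
  by rewrite mulr_ge0_le0 ?sqr_ge0.
apply: (@le_trans _ _ (\sum_j 8 * M j ^+ 2 * (256 / N%:R) * \int[la]_w (sqnorm w * K j w))).
  by rewrite gerDr mulr_ge0_le0.
rewrite /C mulr_suml le_eqVlt; apply/orP; left; apply/eqP.
by apply: eq_bigr => j _; ring.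
Qed.

End liouville.

(** * Regularity of solutions *)

Section regularity.
Context {R : realType} {n : nat}.
Local Notation la := (lebesgue_rV R n).
Implicit Types (r L C G : R) (x y v w : 'rV[R]_n) (u : 'rV[R]_n -> R).

Lemma continuous_enorm : continuous (@enorm R n).
Proof.
by move=> w; apply: (@continuous_comp _ _ _ (@sqnorm R n));
  [exact: continuous_sqnorm|exact: sqrt_continuous].
Qed.

(** The factor [n] arises because [v] is measured coordinatewise, in the sup norm, while [G] bounds
    the Euclidean norm of the gradient. *)
Lemma directional_derivative_bound u G x v : differentiable u x ->
  enorm (gradient u x) <= G -> `|'D_v u x| <= n%:R * G * `|v|.
Proof.
move=> du hG; rewrite deriveE//.
rewrite [X in 'd u x X](row_sum_delta v) linear_sum /=.
apply: (le_trans (ler_norm_sum _ _ _)).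
apply: (@le_trans _ _ (\sum_(j < n) G * `|v|)); last first.
  by rewrite sumr_const card_ord -[leLHS]mulr_natl mulrA.
apply: ler_sum => j _; rewrite linearZ normrM mulrC ler_pM//.
  apply: le_trans hG; apply: le_trans (norm_le_enorm _).
  by apply: le_trans (le_coord_norm _ j); rewrite mxE deriveE.
exact: le_coord_norm.
Qed.

Lemma lipschitz_of_gradient u G : (forall x, differentiable u x) ->
  (forall x, enorm (gradient u x) <= G) ->
  forall x y, `|u x - u y| <= n%:R * G * `|x - y|.
Proof.
move=> du hG x y; pose v := x - y; pose g (t : R) := u (y + t *: v).
have Dg (t : R) : is_derive t (1 : R) g ('D_v u (y + t *: v)).
  have E : (fun h => h^-1 *: ((g \o shift t) (h *: 1) - g t)) =
      (fun h => h^-1 *: ((u \o shift (y + t *: v)) (h *: v) - u (y + t *: v))) :> (R -> R).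
    apply/funext => h; congr (_ *: (_ - _)); rewrite /g /=.
    have -> : h *: (1 : R) = h by exact: mulr1.
    by rewrite scalerDl addrCA.
  have dv : derivable u (y + t *: v) v by exact: diff_derivable.
  split.
    by move: dv; rewrite /derivable -E.
  by rewrite /derive E.
have [c _ hc] : exists2 c, c \in `[0, 1]%R & g 1 - g 0 = 'D_v u (y + c *: v) * (1 - 0).
  apply: (@MVT_segment _ g (fun t => 'D_v u (y + t *: v))) => //.
  apply: derivable_within_continuous => t _.
  by have [] := Dg t.
have -> : u x - u y = g 1 - g 0.
  by rewrite /g scale1r scale0r addr0 /v [y + _]addrC subrK.
by rewrite hc subr0 mulr1; exact: directional_derivative_bound.
Qed.

(** The essential bound holds everywhere: by continuity, a gradient exceeding it at one point
    exceeds it on a ball, which has positive measure. *)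
Lemma bounded_gradient u : C1 u -> gradient_Linfty u ->
  exists2 G, 0 <= G & forall x, enorm (gradient u x) <= G.
Proof.
move=> [du cg]; rewrite /gradient_Linfty Lnorm.unlock.
have ball_gt0 x r : 0 < r -> (0 < la [set y | (`|y - x| <= r)%R])%E.
  by move=> r0; rewrite lebesgue_rV_cball ?(ltW r0)// lte_fin exprn_gt0// mulr_gt0.
(* The definition of the norm of exponent [+oo] branches on whether the whole space has positive
   measure. *)
have -> : (0 < la [set: 'rV[R]_n])%E.
  apply: lt_le_trans (ball_gt0 0 1 ltr01) _.
  by apply: le_measure; rewrite ?inE//; exact: measurable_cball.
move=> /ereal_inf_lt[y /= hy yoo].
have [G G0 yG] : exists2 G, 0 <= G & (y <= G%:E)%E.
  case: y yoo {hy} => [y _|//|_]; last by exists 0; rewrite ?leNye.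
  by exists `|y| => //; rewrite lee_fin ler_norm.
exists G => // x; rewrite leNgt; apply/negP => xG.
have ceg : continuous (fun x => enorm (gradient u x)).
  by move=> z; apply: (@continuous_comp _ _ _ (gradient u) (@enorm R n));
    [exact: cg|exact: continuous_enorm].
have /nbhs_ballP[r /= r0 hr] : nbhs x [set z | G < enorm (gradient u z)].
  by have := @cvgr_gt _ _ _ (nbhs_filter x) _ _ (ceg x) _ xG.
have [N [mN N0 hN]] := hy.
have r2 : 0 < r / 2 by rewrite divr_gt0.
have : (0 < la N)%E.
  apply: lt_le_trans (ball_gt0 x _ r2) _.
  apply: le_measure; rewrite ?inE//; first exact: measurable_cball.
  move=> z /= zr; apply: hN => /= h.
  have : G < enorm (gradient u z).
    apply: (hr z); rewrite -ball_normE /= distrC (le_lt_trans zr)//; lra.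
  rewrite ltNge => /negP; apply; rewrite -lee_fin; apply: le_trans yG.
  by apply: le_trans h; rewrite lee_fin ler_norm.
by rewrite [X in (_ < X)%E]N0 ltxx.
Qed.

Lemma locally_lipschitz_continuous (H : 'rV[R]_n -> R) :
  locally_lipschitz H -> continuous H.
Proof.
move=> HL x; have [U /nbhs_ballP[r /= r0 hr] [L [Lreal hL]]] := HL x.
have {}hL := hL (`|L| + 1) _.
have L1 : L < `|L| + 1 by rewrite (le_lt_trans (ler_norm _))// ltrDl.
have L0 : 0 < `|L| + 1 by rewrite ltr_wpDl.
apply/(@cvgrPdist_le _ _ _ _ (nbhs_filter x)) => e e0.
apply/nbhs_ballP; exists (Num.min r (e / (`|L| + 1))).
  by rewrite /= lt_min r0 divr_gt0.
move=> y; rewrite -ball_normE /= lt_min => /andP[xr /ltW].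
rewrite ler_pdivlMr// mulrC => h; apply: le_trans h.
apply: (hL L1 (x, y)); split => /=; apply: hr; first exact: ballxx.
by rewrite -ball_normE.
Qed.

End regularity.

(** * Second moments of kernels *)

Section moments.
Context {R : realType}.

(** The sets [S k] may overlap: on [D], [F] is dominated by the sum of its restrictions to them, and
    the integrals of these form a geometric series. *)
Lemma integral_cover_lt_pinfty d (T : measurableType d) (mu : {measure set T -> \bar R})
    (D : set T) (S : nat -> set T) (F : T -> R) (A q : R) :
  measurable D -> (forall k, measurable (S k)) -> measurable_fun setT F ->
  (forall x, 0 <= F x) -> (forall x, D x -> F x != 0 -> exists k, S k x) ->
  0 <= A -> 0 <= q < 1 ->
  (forall k, \int[mu]_(x in S k) (F x)%:E <= (A * q ^+ k)%:E)%E ->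
  (\int[mu]_(x in D) (F x)%:E < +oo)%E.
Proof.
move=> mD mS mF F0 cover A0 /andP[q0 q1] hS.
have mF1 k : measurable_fun setT (fun x => (F x)%:E * (\1_(S k) x)%:E)%E.
  by apply: emeasurable_funM; apply/measurable_EFinP => //; exact: measurable_indic.
have F10 k x : (0 <= (F x)%:E * (\1_(S k) x)%:E)%E.
  by rewrite mule_ge0 ?lee_fin// indicE.
apply: (@le_lt_trans _ _ (\int[mu]_x (\sum_(0 <= k <oo) ((F x)%:E * (\1_(S k) x)%:E)))%E).
  rewrite integral_mkcond; apply: ge0_le_integral => //.
  - by move=> x _; rewrite patchE; case: ifP => _; rewrite ?lee_fin.
  - apply/(measurable_restrict _ mD measurableT).
    by rewrite setTI; apply: measurable_funTS; exact/measurable_EFinP.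
  - by apply: ge0_emeasurable_sum => *; [exact: F10|exact: mF1].
  move=> x _; rewrite patchE; case: ifPn => xD; last by apply: nneseries_ge0 => *; exact: F10.
  have [->|Fx] := eqVneq (F x) 0; first by apply: nneseries_ge0 => *; rewrite mul0e.
  have [k Sk] := cover x (set_mem xD) Fx.
  rewrite (nneseriesD1 (n := k)) //.
  by rewrite indicE mem_set//= mule1 leeDl// nneseries_ge0.
rewrite integral_nneseries//.
apply: (@le_lt_trans _ _ (A / (1 - q))%:E); last by rewrite ltry.
apply: lime_le; first by apply: is_cvg_nneseries => *; exact: integral_ge0.
apply: nearW => N.
apply: (@le_trans _ _ (\sum_(0 <= k < N) (A * q ^+ k)%:E)%E).
  apply: lee_sum => k _; apply: le_trans (hS k).
  rewrite [leRHS]integral_mkcond le_eqVlt; apply/orP; left; apply/eqP.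
  by apply: eq_integral => x _; rewrite patchE indicE; case: ifP => _; rewrite ?mule1 ?mule0.
rewrite sumEFin lee_fin ler_pdivlMr ?subr_gt0//.
suff -> : (\sum_(0 <= k < N) A * q ^+ k) * (1 - q) = A - A * q ^+ N.
  by rewrite gerBl mulr_ge0// exprn_ge0.
elim: N => [|N IH]; first by rewrite big_geq// mul0r expr0 mulr1 subrr.
by rewrite big_nat_recr//= mulrDl IH exprS; ring.
Qed.

End moments.

Section kernel_moments.
Context {R : realType} {n : nat}.
Local Notation la := (lebesgue_rV R n).
Implicit Types (r t : R) (w : 'rV[R]_n).
Variables (K : 'rV[R]_n -> R) (kappa : R).
Hypothesis K0 : forall w, 0 <= K w.
Hypothesis mK : measurable_fun setT K.
Hypothesis kappa0 : 0 < kappa.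

Let F w := sqnorm w * K w.

Let F0 w : 0 <= F w. Proof. by rewrite mulr_ge0// sqnorm_ge0. Qed.

Let menorm : measurable_fun setT (@enorm R n).
Proof. by apply: continuous_measurable_rV; exact: continuous_enorm. Qed.

Let mF : measurable_fun setT F.
Proof.
apply: measurable_funM => //; apply: continuous_measurable_rV.
exact: continuous_sqnorm.
Qed.

Lemma measurable_enorm_itv (I : interval R) : measurable [set w : 'rV[R]_n | enorm w \in I].
Proof. by have := menorm measurableT (measurable_itv I); rewrite setTI. Qed.

Lemma powR_exprn (b p : R) k : 0 <= b -> (b ^+ k) `^ p = (b `^ p) ^+ k.
Proof.
by move=> b0; rewrite -(powR_mulrn _ b0) -(powR_mulrn _ (powR_ge0 _ _)) powRAC.
Qed.

Lemma powR_one (p : R) : 1 `^ p = 1.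
Proof. by rewrite powR1. Qed.

(** On the dyadic shell [t < |w| <= 2t] the integrand is at most [(2t)^2 * Lam / t^(n + alpha)] and
    the volume at most [(4t)^n]; the product is of order [t^(2 - alpha)], summable towards the
    origin. *)
Lemma near_moment (Lam alpha : R) : 0 < alpha < 2 -> 0 <= Lam ->
  (forall w, w != 0 -> enorm w <= kappa -> K w <= Lam / enorm w `^ (n%:R + alpha)) ->
  (\int[la]_(w in [set w | (enorm w \in `]-oo, kappa])%R]) (sqnorm w * K w)%:E < +oo)%E.
Proof.
move=> /andP[al0 al2] Lam0 hK.
pose t k := kappa / 2 * 2^-1 ^+ k.
have t0 k : 0 < t k by rewrite mulr_gt0 ?divr_gt0// exprn_gt0.
have tS k : t k = 2 * t k.+1 by rewrite /t exprS; field.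
have p0 : 0 < 2 - alpha by lra.
have q1 : 2^-1 `^ (2 - alpha) < 1.
  by rewrite -[ltRHS](powR_one (2 - alpha)) gt0_ltr_powR ?nnegrE//; lra.
apply: (@integral_cover_lt_pinfty _ _ _ la _
  (fun k => [set w | enorm w \in `]t k, 2 * t k]%R]) F
  (4 ^+ n.+1 * Lam * (kappa / 2) `^ (2 - alpha)) (2^-1 `^ (2 - alpha))) => //.
- exact: measurable_enorm_itv.
- by move=> k; exact: measurable_enorm_itv.
- move=> w /=; rewrite in_itv /= => wk Fw.
  have w0 : w != 0 by apply: contraNneq Fw => ->; rewrite /F sqnorm0 mul0r.
  have ew : 0 < enorm w by rewrite (lt_le_trans _ (norm_le_enorm w))// normr_gt0.
  have ex : exists k, t k < enorm w.
    exists (Num.truncn (kappa / 2 / enorm w)).+1.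
    rewrite /t exprVn ltr_pdivrMr ?exprn_gt0// [ltRHS]mulrC -ltr_pdivrMr//.
    rewrite (lt_trans (truncnS_gt _))// -natrX ltr_nat; exact: ltn_expl.
  case: (ex_minnP ex) => k tk kmin; exists k; rewrite in_itv /= tk /=.
  case: k tk kmin => [|k] _ kmin; first by rewrite /t expr0 mulr1 mulrC divfK.
  rewrite -tS leNgt; apply/negP => /kmin; by rewrite ltnn.
- by rewrite !mulr_ge0 ?exprn_ge0 ?powR_ge0.
- by rewrite powR_ge0.
move=> k.
pose B := (2 * t k) ^+ 2 * (Lam / t k `^ (n%:R + alpha)).
have B0 : 0 <= B by rewrite mulr_ge0 ?sqr_ge0// divr_ge0 ?powR_ge0.
have -> : 4 ^+ n.+1 * Lam * (kappa / 2) `^ (2 - alpha) * 2^-1 `^ (2 - alpha) ^+ k =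
  B * (2 * (2 * t k)) ^+ n.
  rewrite -mulrA -powR_exprn// -powRM ?exprn_ge0 ?divr_ge0 ?(ltW kappa0)// -/(t k).
  rewrite powRB; last by rewrite gt_eqF ?implybT.
  rewrite /B (@powRD _ (t k) n%:R alpha); last by rewrite [t k == 0]gt_eqF ?implybT.
  move: (t k) (t0 k) => s s0; rewrite !powR_mulrn ?(ltW s0)// !exprMn exprS.
  have a0 : s `^ alpha != 0 by rewrite gt_eqF// powR_gt0.
  have b0 : s ^+ n != 0 by rewrite gt_eqF// exprn_gt0.
  rewrite (_ : 4 ^+ n = 2 ^+ n * 2 ^+ n); last by rewrite -exprMn; congr (_ ^+ _); ring.
  by move: (s `^ alpha) (s ^+ n) a0 b0 => a b a0 b0; field; rewrite a0 b0.
apply: (@le_trans _ _ (\int[la]_w (B%:E * (\1_(box n (2 * t k)) w)%:E))%E); last first.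
  rewrite ge0_integralZl//; first last.
  - by apply/measurable_EFinP; apply: measurable_indic; exact: measurable_box.
  rewrite integral_indic ?setIT//=; last exact: measurable_box.
  by rewrite lebesgue_rV_box ?mulr_ge0// ?ltW// -EFinM.
rewrite integral_mkcond; apply: ge0_le_integral => //.
- by move=> x _; rewrite patchE; case: ifP => _; rewrite ?lee_fin.
- apply/(measurable_restrict _ (measurable_enorm_itv _) measurableT).
  by rewrite setTI; apply: measurable_funTS; exact/measurable_EFinP.
- by apply: emeasurable_funM => //; apply/measurable_EFinP; apply: measurable_indic;
  exact: measurable_box.
move=> w _; rewrite patchE; case: ifPn => wS; last first.
  by rewrite mule_ge0 ?lee_fin// indicE.
move: (set_mem wS); rewrite /= in_itv /= => /andP[w1 w2].
rewrite -EFinM lee_fin indicE mem_set ?mulr1;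
  last by rewrite /box /= (le_trans (norm_le_enorm w)).
have wk : enorm w <= kappa.
  rewrite (le_trans w2)// /t mulrA mulrCA divff// mulr1 ler_piMr ?(ltW kappa0)//.
  by rewrite exprn_ile1//; lra.
have w0 : w != 0.
  apply: contraTneq w1 => ->; rewrite -leNgt.
  by rewrite (_ : enorm 0 = 0) ?(ltW (t0 k))// /enorm -/(sqnorm 0) sqnorm0 sqrtr0.
rewrite /F /B ler_pM ?sqnorm_ge0//.
  rewrite -enorm_sq; apply: lerXn2r => //; rewrite nnegrE ?enorm_ge0//.
  by rewrite mulr_ge0// ltW.
have ew0 : 0 < enorm w := lt_trans (t0 k) w1.
rewrite (le_trans (hK w w0 wk))// ler_wpM2l// lef_pV2 ?posrE ?powR_gt0//.
apply: ge0_ler_powR; rewrite ?nnegrE ?enorm_ge0 ?(ltW (t0 k))// ?(ltW w1)//.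
by rewrite addr_ge0// ltW.
Qed.

(** An annulus at radius [r] contributes at most [4 * C * r^(2 - theta)]. The annuli are open, so
    those of ratio [2] would miss spheres; the radii grow by the factor [3 / 2] instead, and the
    annuli overlap. *)
Lemma far_moment (C theta : R) : 0 <= C -> 2 < theta ->
  (forall r, kappa < r ->
    (\int[la]_(w in [set w | (enorm w \in `]r, 2 * r[)%R]) (K w)%:E <=
      (C * r `^ (- theta))%:E)%E) ->
  (\int[la]_(w in [set w | (enorm w \in `]kappa, +oo[)%R]) (sqnorm w * K w)%:E < +oo)%E.
Proof.
move=> C0 th2 hK.
(* The bound extends to [r = kappa], the first radius used, since the open annulus is an increasing
   union of annuli with inner radius above [kappa]. *)
have hK' r : kappa <= r ->
    (\int[la]_(w in [set w | (enorm w \in `]r, 2 * r[)%R]) (K w)%:E <=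
      (C * r `^ (- theta))%:E)%E.
  move=> kr; have r0 : 0 < r by exact: lt_le_trans kr.
  pose rj j := r * (1 + j.+1%:R^-1).
  have rrj j : r < rj j by rewrite /rj ltr_pMr// ltrDl invr_gt0.
  pose S j := [set w : 'rV[R]_n | enorm w \in `]rj j, 2 * r[%R].
  have -> : [set w : 'rV[R]_n | enorm w \in `]r, 2 * r[%R] = \bigcup_j S j.
    apply/seteqP; split => w; last first.
      by move=> [j _]; rewrite /S /= !in_itv /= => /andP[h ->]; rewrite (lt_trans (rrj j)).
    rewrite /= in_itv /= => /andP[rw w2].
    have h : 0 < enorm w / r - 1 by rewrite subr_gt0 ltr_pdivlMr// mul1r.
    have [j _ hj] := near_infty_natSinv_lt (PosNum h).
    exists j => //; rewrite /S /= in_itv /= w2 andbT /rj mulrC -ltr_pdivlMr//.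
    have /= := hj j (leqnn j); move: (_.+1%:R^-1) => d; lra.
  apply: (cvge_to_le (ge0_nondecreasing_set_cvg_integral (F := S) (mu := la) _ _ _ _)).
  - move=> i j ij; apply/subsetPset => w; rewrite /S /= !in_itv /= => /andP[h ->].
    rewrite andbT; apply: le_lt_trans h; rewrite /rj ler_wpM2l ?(ltW r0)// lerD2l.
    by rewrite lef_pV2 ?posrE// ler_nat.
  - by move=> j; exact: measurable_enorm_itv.
  - by move=> j; apply: measurable_funTS; exact/measurable_EFinP.
  - by move=> j w _; rewrite lee_fin.
  apply: nearW => j.
  apply: (@le_trans _ _ (\int[la]_(w in [set w | (enorm w \in `]rj j, 2 * rj j[)%R])
    (K w)%:E)%E).
    apply: ge0_subset_integral => //; try exact: measurable_enorm_itv.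
    - by apply: measurable_funTS; exact/measurable_EFinP.
    - by move=> w _; rewrite lee_fin.
    - move=> w; rewrite /S /= !in_itv /= => /andP[h1 h2]; rewrite h1 (lt_le_trans h2)//.
      by rewrite ler_wpM2l// ltW.
  apply: (le_trans (hK _ (le_lt_trans kr (rrj j)))).
  have rj0 : 0 < rj j := lt_trans r0 (rrj j).
  rewrite lee_fin ler_wpM2l// !powRN lef_pV2 ?posrE ?powR_gt0//.
  by apply: ge0_ler_powR; rewrite ?nnegrE ?(ltW (lt_trans r0 (rrj j))) ?(ltW r0)
    ?(ltW (rrj j))//; lra.
pose b : R := 3 / 2.
have b1 : 1 < b by rewrite /b; lra.
have b0 : 0 < b by lra.
pose r k := kappa * b ^+ k.
have r0 k : 0 < r k by rewrite mulr_gt0// exprn_gt0.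
have q0 : 0 <= b `^ (2 - theta) by exact: powR_ge0.
have q1 : b `^ (2 - theta) < 1.
  rewrite -opprB powRN invf_lt1 ?powR_gt0//.
  by rewrite -[ltLHS](powR_one (theta - 2)) gt0_ltr_powR ?nnegrE//; lra.
apply: (@integral_cover_lt_pinfty _ _ _ la _
  (fun k => [set w | enorm w \in `]r k, 2 * r k[%R]) F
  (4 * C * kappa `^ (2 - theta)) (b `^ (2 - theta))) => //.
- exact: measurable_enorm_itv.
- by move=> k; exact: measurable_enorm_itv.
- move=> w /=; rewrite in_itv /= andbT => kw _.
  have ex : exists k, enorm w < 2 * r k.
    (* Two steps of ratio [3 / 2] multiply the radius by [9 / 4 >= 2], so [N + N] of them reach
       [2 ^ N]. *)
    pose N := Num.truncn (enorm w / kappa).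
    exists (N + N)%N; rewrite /r [ltRHS]mulrCA [ltRHS]mulrC -ltr_pdivrMr//.
    rewrite (lt_le_trans (truncnS_gt _))// -/N.
    have h1 : 2 ^+ N <= b ^+ (N + N).
      by rewrite exprD -exprMn lerXn2r ?nnegrE//; rewrite /b; lra.
    apply: (@le_trans _ _ (2 * 2 ^+ N)); last by rewrite ler_wpM2l.
    rewrite -exprS -natrX ler_nat; apply: ltnW; exact: ltn_expl.
  case: (ex_minnP ex) => k rk kmin; exists k; rewrite in_itv /= rk andbT.
  case: k rk kmin => [|k] _ kmin; first by rewrite /r expr0 mulr1.
  have h : 2 * r k <= enorm w by rewrite leNgt; apply/negP => /kmin; rewrite ltnn.
  apply: lt_le_trans h; have := r0 k; rewrite /r exprS; move: (b ^+ k) => bk.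
  by rewrite /b; lra.
- by rewrite !mulr_ge0 ?powR_ge0.
- by rewrite q0.
move=> k; have kr : kappa <= r k by rewrite /r ler_peMr ?(ltW kappa0)// exprn_ege1// ltW.
apply: (@le_trans _ _ (\int[la]_(w in [set w | (enorm w \in `]r k, 2 * r k[)%R])
  ((4 * r k ^+ 2)%:E * (K w)%:E))%E).
  apply: ge0_le_integral => //; try exact: measurable_enorm_itv.
  - by move=> w _; rewrite lee_fin F0.
  - by apply: measurable_funTS; exact/measurable_EFinP.
  - by apply: emeasurable_funM => //; apply: measurable_funTS; exact/measurable_EFinP.
  move=> w; rewrite /= in_itv /= => /andP[_ w2]; rewrite -EFinM lee_fin ler_wpM2r//.
  rewrite -enorm_sq (_ : 4 * _ = (2 * r k) ^+ 2); last by ring.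
  apply: lerXn2r; rewrite ?nnegrE ?enorm_ge0 ?(ltW w2)//.
  by rewrite mulr_ge0// ltW.
rewrite ge0_integralZl//; first last.
- by rewrite lee_fin mulr_ge0// sqr_ge0.
- by move=> w _; rewrite lee_fin.
- by apply: measurable_funTS; exact/measurable_EFinP.
- exact: measurable_enorm_itv.
apply: (@le_trans _ _ ((4 * r k ^+ 2)%:E * (C * r k `^ (- theta))%:E)%E).
  by apply: lee_wpmul2l; [rewrite lee_fin mulr_ge0// sqr_ge0|exact: hK'].
rewrite -EFinM lee_fin le_eqVlt; apply/orP; left; apply/eqP.
rewrite -[RHS]mulrA -powR_exprn ?(ltW b0)// -powRM ?exprn_ge0 ?(ltW kappa0) ?(ltW b0)// -/(r k).
rewrite (@powRD _ (r k) 2 (- theta)); last by rewrite [r k == 0]gt_eqF ?implybT.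
by rewrite powR_mulrn ?(ltW (r0 k))//; ring.
Qed.

End kernel_moments.

(** * From the kernel conditions to Borel kernels, and conclusion *)

Section admissible.
Context {R : realType} {n : nat}.
Local Notation la := (lebesgue_rV R n).
Implicit Types (J K u f : 'rV[R]_n -> R) (Z : set 'rV[R]_n).

(** The data of one equation in a form that is stable under adding a constant to [u], up to a change
    of [M]. The lower bound on [K] is required only off the null set [Z], where the Borel version
    agrees with the original kernel. *)
Definition admissible u f K Z (L M k0 d0 : R) : Prop :=
  [/\ [/\ forall w, 0 <= K w, measurable_fun setT K, even_fun K &
        la.-integrable setT (EFin \o (fun w => sqnorm w * K w))],
      [/\ measurable Z, la Z = 0%E, 0 < k0, 0 < d0 &
        forall w, ~ Z w -> w != 0 -> `|w| <= d0 -> k0 <= K w],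
      [/\ 0 <= L, forall x y, `|u x - u y| <= L * `|x - y| & forall x, `|u x| <= M],
      principal_value K u f & continuous f].

Lemma liouville_admissible m (u f : 'I_m -> 'rV[R]_n -> R) : (n <= 2)%N ->
  (forall i, exists K Z L M k0 d0, admissible (u i) (f i) K Z L M k0 d0) ->
  (forall x, \sum_i u i x * f i x <= 0) ->
  forall i, exists a, forall x, u i x = a.
Proof.
move=> n2 H sum0.
have [K {}H] := choice H; have [Z {}H] := choice H; have [L {}H] := choice H.
have [M {}H] := choice H; have [k0 {}H] := choice H; have [d0 {}H] := choice H.
by apply: (@liouville_system R m n n2 K u f L M k0 d0 Z) => // i;
  case: (H i) => -[? ? ? ?] [? ? ? ? ?] [? ? ?] ? ?.
Qed.

(** The exchange of [J] for the Borel kernel [K] precedes the translation, because invariance of the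
    integral is established for Borel functions; at the point [x] the exceptional set is the
    translate of [Z]. *)
Lemma principal_value_null_modification J K Z u f : measurable_fun setT K -> measurable Z ->
  la Z = 0%E -> (forall w, ~ Z w -> K w = J w) -> continuous u ->
  (forall x, nonlocal_operator_at J u x (f x)) -> principal_value K u f.
Proof.
move=> mK mZ Z0 KJ cu Ju x; apply: cvg_trans (Ju x); apply: near_eq_cvg; near=> r.
have mu := continuous_measurable_rV cu.
have mshiftx : measurable_fun setT (fun w : 'rV[R]_n => w - x) by exact: measurable_rV_shift.
pose N := (fun z => 1 *: z + (- x)) @^-1` Z.
have mN : measurable N.
  by rewrite -[X in measurable X]setTI; exact: measurable_rV_affine.
have N0 : la N = 0%E by rewrite /N lebesgue_rV_affine//; left.
have mD : measurable (~` eball x r).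
  have := mshiftx measurableT _ (measurable_eballC r).
  by rewrite setTI; congr measurable; apply/seteqP; split => z; rewrite /eball /= subr0.
pose G z := ((u x - u z) * K (z - x))%:E.
rewrite /truncated_operator (@eq_integral_off_null _ _ _ la _ N _ G)//; last first.
  by move=> z _ Nz; rewrite /G KJ//; move: Nz; rewrite /N /= scale1r.
rewrite [LHS]integral_mkcond -(integral_rV_shift x); last first.
  apply/(measurable_restrict _ mD measurableT); rewrite setTI; apply: measurable_funTS.
  apply/measurable_EFinP; apply: measurable_funM; first exact: measurable_funB.
  exact: (measurableT_comp mK mshiftx).
rewrite [RHS]integral_mkcond; apply: eq_integral => w _; rewrite !patchE.
have -> : (w + x \in ~` eball x r) = (w \in ~` eball 0 r).
  by apply/idP/idP => /set_mem h; apply/mem_set; move: h; rewrite /eball /= addrK subr0.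
by rewrite /G addrK [x + w]addrC.
Unshelve. all: by end_near. Qed.

Lemma enorm_gt0_neq0 (w : 'rV[R]_n) : 0 < enorm w -> w != 0.
Proof.
move=> ew; apply: contraTneq ew => ->.
by rewrite /enorm -/(sqnorm 0) sqnorm0 sqrtr0 ltxx.
Qed.

Lemma integrable_moment K (kappa : R) : (forall w, 0 <= K w) -> measurable_fun setT K ->
  (\int[la]_(w in [set w | (enorm w \in `]-oo, kappa])%R]) (sqnorm w * K w)%:E < +oo)%E ->
  (\int[la]_(w in [set w | (enorm w \in `]kappa, +oo[)%R]) (sqnorm w * K w)%:E < +oo)%E ->
  la.-integrable setT (EFin \o (fun w => sqnorm w * K w)).
Proof.
move=> K0 mK near far.
have mF : measurable_fun setT (fun w => sqnorm w * K w).
  by apply: measurable_funM => //; apply: continuous_measurable_rV; exact: continuous_sqnorm.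
apply: ge0_integrable => // [w _|]; first by rewrite mulr_ge0// sqnorm_ge0.
have -> : [set: 'rV[R]_n] = [set w | (enorm w \in `]-oo, kappa])%R] `|`
  [set w | (enorm w \in `]kappa, +oo[)%R].
  apply/seteqP; split => // w _; rewrite /= !in_itv /= andbT.
  by have [h|h] := leP (enorm w) kappa; [left|right].
rewrite ge0_integral_setU//; try exact: measurable_enorm_itv.
- exact: lte_add_pinfty.
- by apply: measurable_funTS; exact/measurable_EFinP.
- by move=> w _; rewrite lee_fin mulr_ge0// sqnorm_ge0.
- apply/disj_set2P; apply/seteqP; split => // w [] /=; rewrite !in_itv /= andbT => h1 h2.
  by move: (le_lt_trans h1 h2); rewrite ltxx.
Qed.

End admissible.

Lemma continuous_state (R : realType) (m n : nat) (u : 'I_m -> 'rV[R]_n -> R) :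
  (forall i, exists2 L, 0 <= L & forall x y, `|u i x - u i y| <= L * `|x - y|) ->
  continuous (state u).
Proof.
move=> lip x.
have lip' i : exists l : R, 0 <= l /\ forall x y, `|u i x - u i y| <= l * `|x - y|.
  by have [l l0 ul] := lip i; exists l.
have [L hL] := choice lip'.
pose B := \sum_i L i + 1.
have B0 : 0 < B by rewrite ltr_wpDl// sumr_ge0// => i _; case: (hL i).
apply/(@cvgrPdist_le _ _ _ _ (nbhs_filter x)) => e e0.
apply/nbhs_ballP; exists (e / B); first by rewrite /= divr_gt0.
move=> y; rewrite -ball_normE /= => /ltW; rewrite ler_pdivlMr// mulrC => h.
apply: norm_le_coord => [|i]; first exact: ltW.
rewrite !mxE (le_trans ((hL i).2 _ _))//; apply: le_trans h; rewrite ler_wpM2r//.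
rewrite /B (bigD1 i)//= -addrA lerDl addr_ge0// sumr_ge0// => j _.
by case: (hL j).
Qed.

(** The common content of the two kernel conditions: model bounds near the origin, and a tail that
    either vanishes or decays on annuli. *)
Lemma regular_kernel (R : realType) (n : nat) (n_ge1 : (1 <= n)%N)
    (J c : 'rV[R]_n -> R) (alpha delta kappa lambda Lambda : R) :
  0 < alpha < 2 -> 0 < delta <= kappa -> 0 < lambda <= Lambda ->
  (forall x, lambda <= c x <= Lambda) -> jump_kernel J ->
  (forall w, w != 0 -> enorm w <= kappa -> J w <= c w / enorm w `^ (n%:R + alpha)) ->
  (forall w, w != 0 -> enorm w <= delta -> c w / enorm w `^ (n%:R + alpha) <= J w) ->
  (forall w, kappa < enorm w -> J w = 0) \/
  (exists (C theta : R), [/\ 0 <= C, 2 < theta & forall r, kappa < r ->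
    (\int[lebesgue_rV R n]_(w in [set w | (enorm w \in `]r, 2 * r[)%R]) (J w)%:E
       <= (C * r `^ (- theta))%:E)%E]) ->
  exists (K : 'rV[R]_n -> R) (Z : set 'rV[R]_n) (k0 d0 : R),
    [/\ [/\ forall w, 0 <= K w, measurable_fun setT K, even_fun K &
          (lebesgue_rV R n).-integrable setT (EFin \o (fun w => sqnorm w * K w))],
        [/\ measurable Z, lebesgue_rV R n Z = 0%E, 0 < k0, 0 < d0 &
          forall w, ~ Z w -> w != 0 -> `|w| <= d0 -> k0 <= K w] &
        forall w, ~ Z w -> K w = J w].
Proof.
move=> al /andP[de0 dk] /andP[la0 lL] cb [J0 mJ eJ] Jle Jge tail.
have [Z [mZ Z0 mK eK]] := even_borel_version mJ eJ.
set K := J \* _ in mK eK.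
have ka0 : 0 < kappa := lt_le_trans de0 dk.
have KJ w : ~ Z w -> K w = J w.
  by move=> Zw; rewrite /K /= indicE mem_set//= mulr1.
have K0 w : 0 <= K w by rewrite /K /= mulr_ge0// indicE.
have KleJ w : K w <= J w.
  by rewrite /K /= ler_piMr// indicE; case: (_ \in _).
have n0 : 0 < n%:R :> R by rewrite ltr0n.
have p0 : 0 <= n%:R + alpha by case/andP: al => a0 _; rewrite addr_ge0 ?ltW.
(* The model kernel is at least [lambda / delta^(n + alpha)] on the Euclidean ball of radius
   [delta], which contains the sup ball of radius [delta / n]. *)
exists K, Z, (lambda / delta `^ (n%:R + alpha)), (delta / n%:R); split => //; split => //.
- apply: (integrable_moment (kappa := kappa)) => //.
    apply: (@near_moment _ _ K kappa K0 mK ka0 Lambda alpha) => //.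
      by rewrite (le_trans _ lL)// ltW.
    move=> w w0 wk; rewrite (le_trans (KleJ w))// (le_trans (Jle w w0 wk))//.
    by rewrite ler_wpM2r ?invr_ge0 ?powR_ge0//; case/andP: (cb w).
  case: tail => [Jtail|[C [theta [C0 th2 hC]]]].
    rewrite (@integral0_eq _ _ _ _ _ (fun w => (sqnorm w * K w)%:E)) ?ltry// => w.
    rewrite /= in_itv /= andbT => wk.
    suff -> : K w = 0 by rewrite mulr0.
    by apply/eqP; rewrite eq_le K0 andbT -(Jtail w wk).
  apply: (far_moment K0 mK ka0 C0 th2) => r kr; apply: le_trans (hC r kr).
  (* This comparison asks for no Borel measurability of the larger function [J]. *)
  apply: (ge0_le_integral_off_null (N := set0)) => //; last by move=> w _ _; rewrite lee_fin.
  exact: measurable_enorm_itv.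
- by rewrite divr_gt0// powR_gt0.
- by rewrite divr_gt0.
move=> w Zw w0; rewrite ler_pdivlMr// mulrC => wd; rewrite KJ//.
have ewd : enorm w <= delta := le_trans (enorm_le_norm w) wd.
have ew : 0 < enorm w by rewrite (lt_le_trans _ (norm_le_enorm w))// normr_gt0.
apply: le_trans (Jge w w0 ewd); apply: ler_pM => //.
- exact: ltW.
- by rewrite invr_ge0 powR_ge0.
- by case/andP: (cb w).
rewrite lef_pV2 ?posrE ?powR_gt0//.
by apply: ge0_ler_powR; rewrite ?nnegrE ?(ltW ew) ?(ltW de0).
Qed.

Theorem theorem3p2 (R : realType) (m n : nat)
  (m_ge1 : (1 <= m)%N) (n_ge1 : (1 <= n)%N) (n_le2 : (n <= 2)%N)
  (alpha delta kappa lambda Lambda : 'I_m -> R)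
  (c J : 'I_m -> 'rV[R]_n -> R)
  (H : 'I_m -> 'rV[R]_m -> R) (u : 'I_m -> 'rV[R]_n -> R)
  (alpha_range : forall i, 0 < alpha i < 2)
  (delta_kappa : forall i, 0 < delta i <= kappa i)
  (lambda_Lambda : forall i, 0 < lambda i <= Lambda i)
  (c_measurable : forall i, lebesgue_measurable (c i))
  (c_even : forall i, even_fun (c i))
  (c_bounds : forall i x, lambda i <= c i x <= Lambda i)
  (J_kernel : forall i, jump_kernel (J i))
  (H_lipschitz : forall i, locally_lipschitz (H i))
  (u_solution : solution J H u)
  (u_bounded : forall i, bounded_fun (u i))
  (J_condition :
     finite_range J c alpha delta kappa \/
     exists (C : R) (h : 'I_m -> R -> R) (theta : 'I_m -> R),
       [/\ 0 < C, decay J c alpha kappa C h &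
           forall i, 3 < theta i /\
             forall r, 0 < r -> h i r < C * r `^ (- theta i)]) :
  (forall i, (forall x, 0 <= H i (state u x)) ->
     exists a, forall x, u i x = a) /\
  ((forall x, \sum_(i < m) u i x * H i (state u x) <= 0) ->
     forall i, exists a, forall x, u i x = a).
Proof.
(* Both conditions on [J] yield the same kernel data; the proof distinguishes them only here. *)
have kern i : exists (K : 'rV[R]_n -> R) (Z : set 'rV[R]_n) (k0 d0 : R),
    [/\ [/\ forall w, 0 <= K w, measurable_fun setT K, even_fun K &
          (lebesgue_rV R n).-integrable setT (EFin \o (fun w => sqnorm w * K w))],
        [/\ measurable Z, lebesgue_rV R n Z = 0%E, 0 < k0, 0 < d0 &
          forall w, ~ Z w -> w != 0 -> `|w| <= d0 -> k0 <= K w] &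
        forall w, ~ Z w -> K w = J i w].
  have eJ : even_fun (J i) by case: (J_kernel i).
  have J0 w : 0 <= J i w by case: (J_kernel i).
  apply: (regular_kernel n_ge1 (alpha_range i) (delta_kappa i) (lambda_Lambda i)
    (c_bounds i) (J_kernel i)).
  - move=> w w0 wk; case: J_condition => [fr|[C [h [theta [_ dec _]]]]].
      by have [_] := fr i w 0 w0; rewrite subr0 indicE mem_set//= mulr1.
    by have [/(_ w 0 w0) + _ _ _ _] := dec i; rewrite subr0 => ->.
  - move=> w w0 wd; case: J_condition => [fr|[C [h [theta [_ dec _]]]]].
      by have [+ _] := fr i w 0 w0; rewrite subr0 indicE mem_set//= mulr1.
    have [/(_ w 0 w0) + _ _ _ _] := dec i; rewrite subr0 => -> //.
    by case/andP: (delta_kappa i) => _; exact: le_trans.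
  case: J_condition => [fr|[C [h [theta [C0 dec hth]]]]]; [left|right].
    move=> w wk; have w0 : w != 0.
      apply: enorm_gt0_neq0; apply: lt_trans wk.
      by case/andP: (delta_kappa i) => d0 /(lt_le_trans d0).
    have [_] := fr i w 0 w0; rewrite subr0 indicE memNset; last first.
      by rewrite /=; apply/negP; rewrite -ltNge.
    by rewrite mulr0 => Jw; apply/eqP; rewrite eq_le Jw J0.
  (* One factor [C] comes from the annulus bound [C * h i r], the other from the bound on
     [h i r]. *)
  have [th3 hlt] := hth i; exists (C * C), (theta i); split.
  - by rewrite mulr_ge0// ltW.
  - by apply: lt_trans th3; rewrite ltr_nat.
  (* The decay bound is read at [x = 0]; evenness of the norm and of [J i] removes the sign in
     [0 - z]. *)
  move=> r kr; have [_ /(_ 0 r kr) hint _ _ _] := dec i.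
  have r0 : 0 < r.
    by apply: lt_trans kr; case/andP: (delta_kappa i) => d0 /(lt_le_trans d0).
  apply: (@le_trans _ _ (C * h i r)%:E); last first.
    by rewrite lee_fin -mulrA ler_wpM2l ?(ltW C0)// ltW// hlt.
  apply: le_trans hint; rewrite le_eqVlt; apply/orP; left; apply/eqP.
  have -> : [set w : 'rV[R]_n | enorm w \in `]r, 2 * r[] = [set z | r < enorm (0 - z) < 2 * r].
    by apply/seteqP; split => w; rewrite /= in_itv /= sub0r /enorm -!/(sqnorm _) sqnormN.
  by apply: eq_integral => w _; rewrite sub0r eJ ger0_norm.
have [u_C1 u_grad u_pde] := u_solution.
have lip i : exists2 L, 0 <= L & forall x y, `|u i x - u i y| <= L * `|x - y|.
  have [G G0 hG] := bounded_gradient (u_C1 i) (u_grad i).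
  exists (n%:R * G); first by rewrite mulr_ge0.
  by apply: lipschitz_of_gradient => //; case: (u_C1 i).
have bnd i : exists M, forall x, `|u i x| <= M.
  have [M [_ hM]] := u_bounded i; exists (M + 1) => x.
  by apply: (hM (M + 1)) => //; rewrite ltrDl.
have cu i : continuous (u i).
  by have [L _ uL] := lip i; exact: continuous_of_lipschitz uL.
have cf i : continuous (fun x => H i (state u x)).
  move=> x; apply: (@continuous_comp _ _ _ (state u) (H i));
    last exact: locally_lipschitz_continuous.
  exact: continuous_state.
(* The operator sees only differences of [u i], so a constant [M0] may be subtracted without
   changing the equation: an upper bound of [u i] for the first claim, [0] for the second. *)
have adm i (M0 : R) : exists K Z L M k0 d0,
    admissible (fun x => u i x - M0) (fun x => H i (state u x)) K Z L M k0 d0.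
  have [K [Z [k0 [d0 [HK HZ KJ]]]]] := kern i.
  have [L L0 uL] := lip i; have [M uM] := bnd i.
  exists K, Z, L, (M + `|M0|), k0, d0; split => //.
  - split => // [x y|x]; last by rewrite (le_trans (ler_normB _ _))// lerD2r.
    by rewrite opprB addrA subrK.
  have [_ mK _ _] := HK; have [mZ Z0 _ _ _] := HZ.
  have upv : principal_value K (u i) (fun x => H i (state u x)).
    exact: (principal_value_null_modification mK mZ Z0 KJ (cu i) (u_pde i)).
  move=> x; apply: cvg_trans (upv x); apply: near_eq_cvg; apply: nearW => r.
  by apply: eq_integral => w _; congr (_ * _)%:E; ring.
split.
  move=> i Hi; have [M uM] := bnd i.
  (* A family with one member: the right-hand side still involves the whole state [u], but enters
     only as a given function of [x]. *)
  have := @liouville_admissible R n 1 (fun _ x => u i x - M) (fun _ x => H i (state u x)) n_le2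
    (fun _ => adm i M).
  move=> /(_ _ ord0)[x|a ha]; last by exists (a + M) => x; rewrite -(ha x) subrK.
  rewrite big_ord1 mulr_le0_ge0// subr_le0.
  exact: le_trans (ler_norm _) (uM x).
move=> Hsum; apply: (liouville_admissible n_le2 _ Hsum) => i.
have <- : (fun x => u i x - 0) = u i by apply/funext => x; rewrite subr0.
exact: adm.
Qed.
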